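(* Let $G$ be a cell complex given by a subset of the quadrilaterals of the $\mathbb{Z}^2$ lattice in $\mathbb{R}^2$, with $G$ and its dual $G^*$ simply connected, and let $V(G)$ be its vertex set. Fix the constant $\ell_0>0$ (the common ring area being $\pi\ell_0^2$). (1) An orthogonal ring pattern on $G$ is uniquely determined (up to Euclidean motion) by its $\rho$-radii function $\rho:V(G)\to\mathbb{R}$. (2) A function $\rho:V(G)\to\mathbb{R}$ describes the $\rho$-radii of an orthogonal ring pattern on $G$ with boundary cone angles $\Theta_i$ if and only if it satisfies $$\sum_{j:\, v_j\sim v_i} 2\arctan\left(e^{\rho_i-\rho_j}\right)=\begin{cases}2\pi & \text{for interior vertices } v_i,\\ \pi\,\mathrm{Val}(i)-\Theta_i & \text{for boundary vertices } v_i \text{ with } \rho_i>0,\\ -\Theta_i & \text{for boundary vertices } v_i \text{ with } \rho_i<0.\end{cases}$$ Here the sum is taken over all neighboring vertices $v_j$ of $v_i$, and $\mathrm{Val}(i)$ is the number of rings neighboring the boundary ring $i$.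
   Context: **Complex.** $G$ is a cell complex defined by a subset of the quadrilaterals (unit squares) of the $\mathbb{Z}^2$ lattice in $\mathbb{R}^2$. Its vertices are $v_{m,n}$, $(m,n)\in\mathbb{Z}^2$; edges are horizontal $(v_{m,n},v_{m+1,n})$ or vertical $(v_{m,n},v_{m,n+1})$; $v_i\sim v_j$ means that $v_i,v_j$ are joined by an edge (are neighbors). Inner (interior) vertices have four neighbors; vertices with fewer neighbors are boundary vertices. The dual complex $G^*$ has the 2-cells of $G$ as vertices, and its edges correspond to the edges of $G$ shared by two neighboring 2-cells. **Rings.** A ring is a pair of concentric circles in $\mathbb{R}^2$: an inner circle $c$ of signed radius $r\in\mathbb{R}$ and an outer circle $C$ of radius $R>0$, the area being $\pi(R^2-r^2)$. $r>0$ corresponds to counter-clockwise and $r<0$ to clockwise orientation; if $r=0$ the inner circle degenerates to its center, and orthogonal intersection of $C'$ with $c$ means that $C'$ passes through that point. Subscripts denote the vertex to which a ring is associated; vertices are identified with ring centers. **Orthogonal ring pattern on $G$.** An assignment of rings to the vertices of $G$ such that: (i) rings at neighboring vertices $v_i,v_j$ intersect orthogonally, i.e. $C_i$ intersects $c_j$ orthogonally and $C_j$ intersects $c_i$ orthogonally; (ii) in each square of $G$ the inner circles $c_{m,n}$, $c_{m+1,n+1}$ and the outer circles $C_{m,n+1}$, $C_{m+1,n}$ pass through one point (orthogonality then implies that the two inner circles touch and the two outer circles touch at this point); (iii) for any ring $(C_{m,n},c_{m,n})$ the four touching points $C_{m,n}\cap C_{m+1,n-1}$, $c_{m,n}\cap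 c_{m+1,n+1}$, $C_{m,n}\cap C_{m-1,n+1}$, $c_{m,n}\cap c_{m-1,n-1}$ have the same orientation as $c_{m,n}$: they are in counter-clockwise order if $r_{m,n}>0$ and in clockwise order if $r_{m,n}<0$. **$\rho$-radii.** All rings of an orthogonal ring pattern have the same area, written $\pi\ell_0^2$, so $R_i^2-r_i^2=\ell_0^2$. The $\rho$-radius $\rho_i\in\mathbb{R}$ is defined by $R_i=\ell_0\cosh\rho_i$, $r_i=\ell_0\sinh\rho_i$. **Angles.** For neighboring $v_i,v_j$, let $\varphi_{ij}$ be the signed angle at $v_i$ of the cyclic quadrilateral formed by the two centers and the intersection points $p\in c_i\cap C_j$ and $q\in C_i\cap c_j$: for $\rho_i\neq0$, $\varphi_{ij}$ is the sum of the angle at $v_i$ of the right triangle $v_i,p,v_j$ with legs $|r_i|,R_j$, taken with the sign of $\rho_i$, and the angle at $v_i$ of the right triangle $v_i,q,v_j$ with legs $R_i,|r_j|$, taken with the sign of $\rho_j$; for $\rho_i=0$ only the second of these angles is taken. **Cone angle.** $\Theta_i:=\sum_{j:\,v_j\sim v_i}\varphi_{ij}$. In an orthogonal ring pattern, interior vertices have $\Theta_i=2\pi,0,-2\pi$ according to $\rho_i>0$, $\rho_i=0$, $\rho_i<0$; boundary vertices have $\Theta_i>0$ if $\rho_i>0$ and $\Theta_i<0$ if $\rho_i<0$.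
   Formalization: Patterns must also have, in every square, outer circles touching externally and right triangles oriented by the signs of the inner radii (else one square can be folded, so (1) fails); (iii) is also required at four-neighbor vertices with a missing square. *)

(* Defs.v *)
From Stdlib Require Import Reals ZArith List Permutation Relation_Operators.
Import ListNotations.
Open Scope R_scope.

(** * The lattice and the cell complexes *)

(** [vertex] indexes both the lattice points and the lattice squares; a square
    is named after its lower left corner. *)
Definition vertex := (Z * Z)%type.

Definition east  (v : vertex) : vertex := (fst v + 1, snd v)%Z.
Definition west  (v : vertex) : vertex := (fst v - 1, snd v)%Z.
Definition north (v : vertex) : vertex := (fst v, snd v + 1)%Z.
Definition south (v : vertex) : vertex := (fst v, snd v - 1)%Z.

Definition corners (s : vertex) : list vertex :=
  [s; east s; north (east s); north s].

(** A complex [G] is given by its set of squares, finite or not. *)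
Definition in_V (G : vertex -> bool) (v : vertex) : Prop :=
  exists s, G s = true /\ In v (corners s).

(** The edge from [v] to [east v] (resp. [north v]) is in [G] when one of the
    two lattice squares on its sides is. *)
Definition edge_h (G : vertex -> bool) (v : vertex) : bool :=
  (G v || G (south v))%bool.
Definition edge_v (G : vertex -> bool) (v : vertex) : bool :=
  (G v || G (west v))%bool.

Definition neighbors (G : vertex -> bool) (v : vertex) : list vertex :=
  (if edge_h G v then [east v] else []) ++
  (if edge_v G v then [north v] else []) ++
  (if edge_h G (west v) then [west v] else []) ++
  (if edge_v G (south v) then [south v] else []).

Definition adj (G : vertex -> bool) (v w : vertex) : Prop :=
  In w (neighbors G v).

Definition Val (G : vertex -> bool) (v : vertex) : nat :=
  length (neighbors G v).

(** A reentrant corner (four edges, three squares) is therefore an inner vertex. *)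
Definition inner_vertex (G : vertex -> bool) (v : vertex) : Prop :=
  in_V G v /\ Val G v = 4%nat.
Definition boundary_vertex (G : vertex -> bool) (v : vertex) : Prop :=
  in_V G v /\ (Val G v < 4)%nat.

(** ** Simple connectedness, by the edge-path group of a 2-complex *)

(** 2-complexes whose vertices are lattice points and whose faces are lattice
    squares (named after their lower left corner). *)
Record complex := Complex {
  cvert : vertex -> Prop;
  cedge : vertex -> vertex -> Prop;
  cface : vertex -> Prop }.

Definition primal (G : vertex -> bool) : complex :=
  Complex (in_V G) (adj G) (fun s => G s = true).

(** A vertex of the dual complex is a square of [G].  The dual face with lower
    left corner [s] is dual to the vertex [north (east s)] of [G], and it is
    present when the four squares around that vertex are in [G]. *)
Definition dual (G : vertex -> bool) : complex :=
  Complex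
    (fun s => G s = true)
    (fun s s' => G s = true /\ G s' = true /\
                 In s' [east s; north s; west s; south s])
    (fun s => forall s', In s' (corners s) -> G s' = true).

Fixpoint edge_path (C : complex) (x : vertex) (l : list vertex) : Prop :=
  match l with
  | [] => True
  | y :: l' => cedge C x y /\ edge_path C y l'
  end.

(** [x y z w] is the boundary loop of a face, from any corner and in either
    direction. *)
Definition face_loop (C : complex) (x y z w : vertex) : Prop :=
  (exists s, cface C s /\ Permutation [x; y; z; w] (corners s)) /\
  cedge C x y /\ cedge C y z /\ cedge C z w /\ cedge C w x.

(** Elementary homotopies: inserting a backtracking, and replacing one side of
    a face by the opposite one. *)
Inductive elementary (C : complex) : list vertex -> list vertex -> Prop :=
| elementary_spur l l' x y : cedge C x y ->
    elementary C (l ++ x :: l') (l ++ x :: y :: x :: l')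
| elementary_face l l' x y z w : face_loop C x y z w ->
    elementary C (l ++ x :: y :: z :: l') (l ++ x :: w :: z :: l').

Definition homotopic (C : complex) : list vertex -> list vertex -> Prop :=
  clos_refl_sym_trans (list vertex) (elementary C).

Definition simply_connected (C : complex) : Prop :=
  (forall x y, cvert C x -> cvert C y ->
     exists l, edge_path C x l /\ last l x = y) /\
  (forall x l, cvert C x -> edge_path C x l -> last l x = x ->
     homotopic C (x :: l) [x]).

(** * Plane geometry *)

Definition point := (R * R)%type.

Definition distp (p q : point) : R := dist_euc (fst p) (snd p) (fst q) (snd q).

Definition sgn (x : R) : R :=
  if Rlt_dec 0 x then 1 else if Rlt_dec x 0 then -1 else 0.

(** Twice the signed area of the triangle [p q x]: positive when [x] lies to
    the left of the line from [p] to [q]. *)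
Definition orient (p q x : point) : R :=
  (fst q - fst p) * (snd x - snd p) - (snd q - snd p) * (fst x - fst p).

(** The circles with centers [p], [q] and (signed) radii [a], [b] meet at right
    angles.  For [b = 0] this says that the first circle passes through [q]. *)
Definition orthogonal (p : point) (a : R) (q : point) (b : R) : Prop :=
  exists x : point,
    distp p x = Rabs a /\ distp q x = Rabs b /\
    (fst x - fst p) * (fst x - fst q) + (snd x - snd p) * (snd x - snd q) = 0.

Definition in_direction (p : point) (t : R) (x : point) : Prop :=
  x = (fst p + distp p x * cos t, snd p + distp p x * sin t).

(** Counter-clockwise order as seen from [p]. *)
Definition ccw_order (p x1 x2 x3 x4 : point) : Prop :=
  exists t1 t2 t3 t4 : R,
    t1 < t2 /\ t2 < t3 /\ t3 < t4 /\ t4 < t1 + 2 * PI /\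
    in_direction p t1 x1 /\ in_direction p t2 x2 /\
    in_direction p t3 x3 /\ in_direction p t4 x4.

(** Orientation preserving, since the orientation of the rings is part of a
    pattern. *)
Definition euclidean_motion (g : point -> point) : Prop :=
  exists t a b : R, forall p : point,
    g p = (cos t * fst p - sin t * snd p + a, sin t * fst p + cos t * snd p + b).

(** * Orthogonal ring patterns *)

Record ring := Ring { center : point; inner : R; outer : R }.

Definition is_ring (K : ring) : Prop :=
  0 < outer K /\ Rabs (inner K) < outer K.

Definition on_inner (K : ring) (x : point) : Prop := distp (center K) x = Rabs (inner K).
Definition on_outer (K : ring) (x : point) : Prop := distp (center K) x = outer K.

Definition rings_orthogonal (K L : ring) : Prop :=
  orthogonal (center K) (outer K) (center L) (inner L) /\
  orthogonal (center L) (outer L) (center K) (inner K).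

Definition outer_circles_touch (K L : ring) : Prop :=
  distp (center K) (center L) = outer K + outer L.

(** Let [K], [L] be neighboring rings and let [x] lie on the inner circle of
    [K] and on the outer circle of [L].  The right triangle formed by [x] and
    the two centers carries the orientation of the ring [K]: its angles count
    with the sign of [inner K].  At boundary rings, where the cyclic order of
    the touching points is void, this is what the orientation condition means.
    [left_of K L x] is the convention when [x]
    belongs to a lattice square on the left of the edge from [K] to [L], and
    [right_of K L x] when that square is on the right. *)
Definition left_of (K L : ring) (x : point) : Prop :=
  sgn (orient (center K) (center L) x) = sgn (inner K).
Definition right_of (K L : ring) (x : point) : Prop :=
  sgn (orient (center L) (center K) x) = sgn (inner K).

(** [x] is the touching point in the square with lower left corner [s].  When
    both inner circles are points, tangency of the outer circles is not a
    consequence of orthogonality, hence the explicit requirement. *)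
Definition square_point (P : vertex -> ring) (s : vertex) (x : point) : Prop :=
  on_inner (P s) x /\ on_inner (P (north (east s))) x /\
  on_outer (P (east s)) x /\ on_outer (P (north s)) x /\
  outer_circles_touch (P (east s)) (P (north s)).

Definition square_oriented (P : vertex -> ring) (s : vertex) (x : point) : Prop :=
  left_of (P s) (P (east s)) x /\ right_of (P s) (P (north s)) x /\
  left_of (P (north (east s))) (P (north s)) x /\
  right_of (P (north (east s))) (P (east s)) x.

(** The touching points on the ring [K], seen from its center: [L1] and [L2]
    are consecutive neighbors of [K] in counter-clockwise order around the
    lattice vertex, and [x] is the touching point between them.  It lies on the
    inner circle of [K] in the north-east and south-west quadrants, and on the
    outer circle of [K] in the other two.  The ring at the fourth vertex of the
    lattice square is not involved, so that these also make sense in the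
    missing square at a reentrant corner of [G]; in a square of [G] they
    describe the point given by [square_point] and [square_oriented]. *)
Definition touch_on_inner (K L1 L2 : ring) (x : point) : Prop :=
  on_inner K x /\ on_outer L1 x /\ on_outer L2 x /\ outer_circles_touch L1 L2 /\
  left_of K L1 x /\ right_of K L2 x.
Definition touch_on_outer (K L1 L2 : ring) (x : point) : Prop :=
  on_outer K x /\ on_inner L1 x /\ on_inner L2 x /\
  right_of L1 K x /\ left_of L2 K x.

(** Rings are given on the whole lattice, but only those at the vertices of [G]
    matter. *)
Record ring_pattern (G : vertex -> bool) (P : vertex -> ring) : Prop := {
  pattern_ring : forall v, in_V G v -> is_ring (P v);
  pattern_orthogonal :
    forall v w, in_V G v -> adj G v w -> rings_orthogonal (P v) (P w);
  pattern_square :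
    forall s, G s = true ->
      exists x, square_point P s x /\ square_oriented P s x;
  pattern_vertex :
    forall v, inner_vertex G v ->
      exists se ne nw sw : point,
        touch_on_outer (P v) (P (south v)) (P (east v)) se /\
        touch_on_inner (P v) (P (east v)) (P (north v)) ne /\
        touch_on_outer (P v) (P (north v)) (P (west v)) nw /\
        touch_on_inner (P v) (P (west v)) (P (south v)) sw /\
        (inner (P v) > 0 -> ccw_order (center (P v)) se ne nw sw) /\
        (inner (P v) < 0 -> ccw_order (center (P v)) sw nw ne se) }.

Definition rho_radii (l0 : R) (G : vertex -> bool) (P : vertex -> ring)
    (rho : vertex -> R) : Prop :=
  forall v, in_V G v ->
    outer (P v) = l0 * cosh (rho v) /\ inner (P v) = l0 * sinh (rho v).

Definition congruent (G : vertex -> bool) (P Q : vertex -> ring) : Prop :=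
  exists g : point -> point, euclidean_motion g /\
    forall v, in_V G v ->
      Q v = Ring (g (center (P v))) (inner (P v)) (outer (P v)).

Definition Rsum (l : list R) : R := fold_right Rplus 0 l.

(** The first summand vanishes when [inner (P i) = 0]; the sign of [inner (P i)]
    is that of the rho-radius. *)
Definition phi (P : vertex -> ring) (i j : vertex) : R :=
  sgn (inner (P i)) * atan (outer (P j) / Rabs (inner (P i))) +
  sgn (inner (P j)) * atan (Rabs (inner (P j)) / outer (P i)).

Definition cone_angle (G : vertex -> bool) (P : vertex -> ring) (i : vertex) : R :=
  Rsum (map (phi P i) (neighbors G i)).

(* Main.v *)
(** In a square of the pattern the two outer circles touch at a point [x] in some
    direction [exp (i t)], and the four centers are [x - R], [x + R], [x + i r],
    [x - i r] in that frame. Along an edge shared by two squares the frames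
    differ by the angle [turn (rho_i - rho_j) = 2 atan (exp (rho_i - rho_j)) - PI / 2],
    because [cosh b + i sinh a = (cosh a + i sinh b) exp (i turn (a - b))].

    Uniqueness: the radii determine how a frame changes from a square to the next
    one, and the edges of a square in its frame.

    Existence: the equation at the inner vertices says that the four turns around
    a vertex add up to zero, so the angles of the frames integrate over the simply
    connected dual complex; the edges then close up around each square, and the
    centers integrate over the simply connected primal complex. Conversely, in a
    pattern the sum of the four turns is a multiple of [2 PI] smaller than [2 PI].
    At the boundary, [phi_ij = sgn rho_i * PI / 2 - turn (rho_i - rho_j)]
    depends on the radii only. *)

Require Import Defs.
From Stdlib Require Import Reals ZArith List Lra Lia Permutation Relation_Operators ClassicalEpsilon.
Import ListNotations.
Open Scope R_scope.

(** * The angle [turn] *)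

(** The Gudermannian function: an odd increasing bijection from the reals onto the open interval
    between [- PI / 2] and [PI / 2]. *)
Definition turn (d : R) : R := 2 * atan (exp d) - PI / 2.

Lemma turn_bound (d : R) : - (PI / 2) < turn d < PI / 2.
Proof.
unfold turn; pose proof (atan_bound (exp d)).
assert (0 < atan (exp d)) by (rewrite <- atan_0; apply atan_increasing, exp_pos).
lra.
Qed.

Lemma turn_opp (d : R) : turn (- d) = - turn d.
Proof.
unfold turn; rewrite exp_Ropp, atan_inv by apply exp_pos; lra.
Qed.

Lemma cosh_pos (x : R) : 0 < cosh x.
Proof. unfold cosh; pose proof (exp_pos x); pose proof (exp_pos (- x)); lra. Qed.

Lemma cosh_sqr (x : R) : cosh x * cosh x = 1 + sinh x * sinh x.
Proof.
unfold cosh, sinh.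
assert (exp x * exp (- x) = 1) by (rewrite <- exp_plus, Rplus_opp_r; apply exp_0).
nra.
Qed.

Lemma cos_turn (d : R) : cos (turn d) = / cosh d.
Proof.
unfold turn; rewrite cos_minus, cos_PI2, sin_PI2, sin_2a, sin_atan, cos_atan.
unfold cosh; rewrite exp_Ropp.
assert (He := exp_pos d).
assert (Hs : 0 < 1 + Rsqr (exp d)) by (unfold Rsqr; nra).
assert (Hq := sqrt_lt_R0 _ Hs); assert (H2 := sqrt_sqrt _ (Rlt_le _ _ Hs)).
unfold Rsqr in *.
replace (/ ((exp d + / exp d) / 2)) with (2 * exp d / (1 + exp d * exp d)) by (field; nra).
rewrite <- H2 at 3. field; lra.
Qed.

Lemma sin_turn (d : R) : sin (turn d) = sinh d / cosh d.
Proof.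
unfold turn; rewrite sin_minus, cos_PI2, sin_PI2, cos_2a, sin_atan, cos_atan.
unfold cosh, sinh; rewrite exp_Ropp.
assert (He := exp_pos d).
assert (Hs : 0 < 1 + Rsqr (exp d)) by (unfold Rsqr; nra).
assert (Hq := sqrt_lt_R0 _ Hs); assert (H2 := sqrt_sqrt _ (Rlt_le _ _ Hs)).
unfold Rsqr in *.
replace ((exp d - / exp d) / 2 / ((exp d + / exp d) / 2))
  with ((exp d * exp d - 1) / (1 + exp d * exp d)) by (field; nra).
rewrite <- H2 at 5. field; lra.
Qed.

(** Together: [cosh b + i sinh a = (cosh a + i sinh b) exp (i turn (a - b))]. *)
Lemma cosh_turn (a b : R) :
  cosh b = cosh a * cos (turn (a - b)) - sinh b * sin (turn (a - b)).
Proof.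
rewrite cos_turn, sin_turn.
assert (H : cosh a = cosh b * cosh (a - b) + sinh b * sinh (a - b)).
{ replace a with (b + (a - b)) at 1 by ring.
  unfold cosh, sinh; rewrite !Ropp_plus_distr, !exp_plus; field. }
rewrite H; field. apply Rgt_not_eq, cosh_pos.
Qed.

Lemma sinh_turn (a b : R) :
  sinh a = cosh a * sin (turn (a - b)) + sinh b * cos (turn (a - b)).
Proof.
rewrite cos_turn, sin_turn.
assert (Hs : sinh b = sinh a * cosh (a - b) - cosh a * sinh (a - b)).
{ replace b with (a - (a - b)) at 1 by ring. unfold Rminus at 1.
  unfold cosh, sinh; rewrite !Ropp_plus_distr, !exp_plus, Ropp_involutive; field. }
rewrite Hs; field. apply Rgt_not_eq, cosh_pos.
Qed.

(** Since [cos x = 1 - 2 sin^2 (x / 2)], the half angle is a zero of the sine of absolute value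
    below [PI]. This turns congruences modulo [2 PI] into equalities. *)
Lemma cos_eq_1_0 (x : R) : cos x = 1 -> - (2 * PI) < x < 2 * PI -> x = 0.
Proof.
intros H Hx.
replace x with (2 * (x / 2)) in H by field.
rewrite cos_2a_sin in H.
assert (Hs : sin (x / 2) = 0) by nra.
destruct (Rtotal_order x 0) as [Hn | [-> | Hp]]; trivial.
- assert (0 < sin (- (x / 2))) by (apply sin_gt_0; lra).
  rewrite sin_neg in *; lra.
- assert (0 < sin (x / 2)) by (apply sin_gt_0; lra); lra.
Qed.

Lemma cos_sin_atan_div (x y : R) : 0 < x ->
  x = sqrt (x * x + y * y) * cos (atan (y / x)) /\
  y = sqrt (x * x + y * y) * sin (atan (y / x)).
Proof.
intros Hx; rewrite sin_atan, cos_atan.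
assert (Hp : 0 < 1 + Rsqr (y / x)) by (pose proof (Rle_0_sqr (y / x)); lra).
assert (Hq := sqrt_lt_R0 _ Hp).
replace (sqrt (x * x + y * y)) with (x * sqrt (1 + Rsqr (y / x))).
{ split; field; lra. }
rewrite <- (sqrt_square x) at 1 by lra.
rewrite <- sqrt_mult by nra. f_equal. unfold Rsqr; field; lra.
Qed.

(** The numbers [cosh b + i sinh a] and [cosh a + i sinh b] have the same modulus, the two
    arctangents as arguments, and quotient [exp (i turn (a - b))]. So both sides agree modulo
    [2 PI], and each of the three angles is below [PI / 2] in absolute value. *)
Lemma turn_atan (a b : R) :
  turn (a - b) = atan (sinh a / cosh b) - atan (sinh b / cosh a).
Proof.
destruct (cos_sin_atan_div (cosh b) (sinh a) (cosh_pos b)) as [H1 H2].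
destruct (cos_sin_atan_div (cosh a) (sinh b) (cosh_pos a)) as [H3 H4].
pose proof (atan_bound (sinh a / cosh b)).
pose proof (atan_bound (sinh b / cosh a)).
pose proof (turn_bound (a - b)).
pose proof (cosh_turn a b) as E1; pose proof (sinh_turn a b) as E2.
set (al := atan (sinh a / cosh b)) in *; set (be := atan (sinh b / cosh a)) in *.
set (T := turn (a - b)) in *.
assert (Hpos : 0 < cosh b * cosh b + sinh a * sinh a).
{ pose proof (cosh_pos b); nra. }
replace (cosh a * cosh a + sinh b * sinh b)
  with (cosh b * cosh b + sinh a * sinh a) in *
  by (rewrite !cosh_sqr; ring).
assert (Hm := sqrt_lt_R0 _ Hpos).
set (m := sqrt _) in *.
enough (al - (be + T) = 0) by lra.
apply cos_eq_1_0; [|lra].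
assert (C : cos al = cos (be + T)).
{ rewrite cos_plus. apply Rmult_eq_reg_l with m; [|lra]. nra. }
assert (S : sin al = sin (be + T)).
{ rewrite sin_plus. apply Rmult_eq_reg_l with m; [|lra]. nra. }
rewrite cos_minus, C, S, <- (sin2_cos2 (be + T)); unfold Rsqr; ring.
Qed.

(** * Potentials on simply connected lattice complexes *)

Definition lattice_step (x y : vertex) : Prop :=
  In y [east x; north x; west x; south x].

Lemma west_east (v : vertex) : west (east v) = v.
Proof. destruct v; unfold west, east; cbn; f_equal; lia. Qed.

Lemma east_west (v : vertex) : east (west v) = v.
Proof. destruct v; unfold west, east; cbn; f_equal; lia. Qed.

Lemma south_north (v : vertex) : south (north v) = v.
Proof. destruct v; unfold south, north; cbn; f_equal; lia. Qed.

Lemma north_south (v : vertex) : north (south v) = v.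
Proof. destruct v; unfold south, north; cbn; f_equal; lia. Qed.

(** The 1-cochain on lattice edges with value [a v] on the edge from [v] to
    [east v] and [b v] on the edge from [v] to [north v]. *)
Definition increment (a b : vertex -> R) (x y : vertex) : R :=
  IZR (fst y - fst x) * a (Z.min (fst x) (fst y), snd x) +
  IZR (snd y - snd x) * b (fst x, Z.min (snd x) (snd y)).

Lemma increment_east (a b : vertex -> R) (x : vertex) :
  increment a b x (east x) = a x.
Proof.
destruct x as [m n]; unfold increment, east; cbn [fst snd].
rewrite Z.min_l, Z.sub_diag by lia; replace (m + 1 - m)%Z with 1%Z by lia; ring.
Qed.

Lemma increment_north (a b : vertex -> R) (x : vertex) :
  increment a b x (north x) = b x.
Proof.
destruct x as [m n]; unfold increment, north; cbn [fst snd].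
rewrite (Z.min_l n), Z.sub_diag by lia; replace (n + 1 - n)%Z with 1%Z by lia; ring.
Qed.

Lemma increment_west (a b : vertex -> R) (x : vertex) :
  increment a b x (west x) = - a (west x).
Proof.
destruct x as [m n]; unfold increment, west; cbn [fst snd].
rewrite Z.min_r, Z.sub_diag by lia; replace (m - 1 - m)%Z with (-1)%Z by lia; ring.
Qed.

Lemma increment_south (a b : vertex -> R) (x : vertex) :
  increment a b x (south x) = - b (south x).
Proof.
destruct x as [m n]; unfold increment, south; cbn [fst snd].
rewrite (Z.min_r n), Z.sub_diag by lia; replace (n - 1 - n)%Z with (-1)%Z by lia; ring.
Qed.

Lemma increment_opp (a b : vertex -> R) (x y : vertex) :
  lattice_step x y -> increment a b y x = - increment a b x y.
Proof.
intros [<- | [<- | [<- | [<- | []]]]].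
- rewrite <- (west_east x) at 2.
  rewrite increment_west, increment_east, west_east; ring.
- rewrite <- (south_north x) at 2.
  rewrite increment_south, increment_north, south_north; ring.
- rewrite <- (east_west x) at 2.
  rewrite increment_east, increment_west; ring.
- rewrite <- (north_south x) at 2.
  rewrite increment_north, increment_south; ring.
Qed.

(** A primitive on the four corners handles all face loops of a square at once, whatever their
    starting corner and direction. *)
Lemma increment_square (a b : vertex -> R) (s : vertex) :
  a s + b (east s) = b s + a (north s) ->
  exists g : vertex -> R, forall x y, In x (corners s) -> In y (corners s) ->
    lattice_step x y -> increment a b x y = g y - g x.
Proof.
intros H.
(* The values integrate from [s] along the bottom, left and right sides; the hypothesis makes the
   top side agree. *)
exists (fun p => if Z.eqb (fst p) (fst s)
                 then (if Z.eqb (snd p) (snd s) then 0 else b s)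
                 else (if Z.eqb (snd p) (snd s) then a s else a s + b (east s))).
destruct s as [m n]; unfold corners, lattice_step.
intros x y [<- | [<- | [<- | [<- | []]]]] Hy [<- | [<- | [<- | [<- | []]]]];
  (rewrite increment_east || rewrite increment_north ||
   rewrite increment_west || rewrite increment_south);
  unfold east, north, west, south in *; cbn [fst snd In] in *;
  rewrite ?Z.add_simpl_r;
  repeat match goal with |- context [Z.eqb ?p ?q] =>
    destruct (Z.eqb_spec p q) end;
  try lia; try lra;
  exfalso; destruct Hy as [Hy | [Hy | [Hy | [Hy | []]]]]; inversion Hy; lia.
Qed.

(** * Sums of a cochain along edge paths, and their homotopy invariance *)

Fixpoint path_sum (f : vertex -> vertex -> R) (x : vertex) (l : list vertex) : R :=
  match l with
  | [] => 0
  | y :: l' => f x y + path_sum f y l'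
  end.

Lemma last_cons (l : list vertex) (x y : vertex) : last (y :: l) x = last l y.
Proof.
revert x y; induction l as [|z l IH]; intros x y; trivial.
rewrite (IH y z); apply (IH x z).
Qed.

Lemma path_sum_app (f : vertex -> vertex -> R) (l l' : list vertex) (x : vertex) :
  path_sum f x (l ++ l') = path_sum f x l + path_sum f (last l x) l'.
Proof.
revert x; induction l as [|y l IH]; intros x; cbn [path_sum app].
- cbn; ring.
- rewrite IH, last_cons; ring.
Qed.

Lemma last_app (l l' : list vertex) (x : vertex) :
  last (l ++ l') x = last l' (last l x).
Proof.
revert x; induction l as [|y l IH]; intros x; trivial.
cbn [app]; rewrite !last_cons; apply IH.
Qed.

Lemma edge_path_app (C : complex) (l l' : list vertex) (x : vertex) :
  edge_path C x l -> edge_path C (last l x) l' -> edge_path C x (l ++ l').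
Proof.
revert x; induction l as [|y l IH]; intros x; cbn [edge_path app]; trivial.
rewrite last_cons; intros [H1 H2] H3; split; auto.
Qed.

Lemma reverse_path (C : complex) (f : vertex -> vertex -> R) (l : list vertex) (x : vertex) :
  (forall y z, cedge C y z -> cedge C z y /\ f z y = - f y z) ->
  edge_path C x l ->
  exists l', edge_path C (last l x) l' /\ last l' (last l x) = x /\
    path_sum f (last l x) l' = - path_sum f x l.
Proof.
intros Hsym; revert x; induction l as [|y l IH]; intros x; cbn [edge_path].
- exists []; cbn; repeat split; ring.
- intros [H1 H2]; destruct (IH y H2) as (l' & Hp & Hl & Hs).
  destruct (Hsym _ _ H1) as [H3 H4].
  exists (l' ++ [x]); rewrite last_cons; repeat split.
  + apply edge_path_app; trivial. rewrite Hl; cbn; auto.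
  + now rewrite last_app.
  + rewrite path_sum_app, Hl, Hs; cbn; lra.
Qed.

(** Homotopies relate whole vertex lists, starting point included, whereas [path_sum] takes the
    starting point separately. *)
Definition list_sum (f : vertex -> vertex -> R) (l : list vertex) : R :=
  match l with [] => 0 | x :: l' => path_sum f x l' end.

Lemma list_sum_app (f : vertex -> vertex -> R) (l l' : list vertex) (x : vertex) :
  list_sum f (l ++ x :: l') = list_sum f (l ++ [x]) + path_sum f x l'.
Proof.
destruct l as [|y l]; cbn [list_sum app path_sum].
- ring.
- rewrite !path_sum_app; cbn; ring.
Qed.

(** A spur contributes [f x y + f y x = 0], and a face move exchanges two sides of a square for the
    other two, which have the same sum. *)
Lemma list_sum_homotopic (C : complex) (f : vertex -> vertex -> R) (l l' : list vertex) :
  (forall x y, cedge C x y -> f y x = - f x y) ->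
  (forall x y z w, face_loop C x y z w -> f x y + f y z = f x w + f w z) ->
  homotopic C l l' -> list_sum f l = list_sum f l'.
Proof.
intros Hsym Hface; induction 1 as [l l' H | l | l l' H IH | l1 l2 l3 H1 IH1 H2 IH2].
- destruct H as [l l' x y H | l l' x y z w H].
  + rewrite (list_sum_app f l l'), (list_sum_app f l (y :: _)).
    cbn [path_sum]; rewrite (Hsym _ _ H); ring.
  + rewrite (list_sum_app f l (y :: _)), (list_sum_app f l (w :: _)).
    cbn [path_sum]; pose proof (Hface _ _ _ _ H); lra.
- reflexivity.
- now symmetry.
- now rewrite IH1.
Qed.

(** Poincare lemma: the potential at [x] is the sum of [f] along any path from a base vertex [o] to
    [x]. *)
Lemma potential (C : complex) (f : vertex -> vertex -> R) :
  simply_connected C ->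
  (forall x y, cedge C x y -> cvert C y /\ cedge C y x /\ f y x = - f x y) ->
  (forall x y z w, face_loop C x y z w -> f x y + f y z = f x w + f w z) ->
  exists h : vertex -> R,
    forall x y, cvert C x -> cedge C x y -> h y = h x + f x y.
Proof.
intros [Hconn Hloop] Hedge Hface.
destruct (excluded_middle_informative (exists o, cvert C o)) as [[o Ho] | Hno].
2: { exists (fun _ => 0); intros x y Hx; destruct Hno; eauto. }
pose (Q x r := exists l, edge_path C o l /\ last l o = x /\ r = path_sum f o l).
assert (HQ : forall x r r', Q x r -> Q x r' -> r = r').
{ intros x r r' (l & Hl & El & ->) (l' & Hl' & El' & ->).
  (* Going out along [l] and back along [l'] gives a loop at [o]; it is contractible, so its sum is
     0 and the two sums agree. *)
  destruct (reverse_path C f l' o) as (m & Hm & Em & Sm); trivial.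
  { intros y z H; destruct (Hedge _ _ H) as (_ & ? & ?); auto. }
  rewrite El' in *.
  assert (H : homotopic C (o :: l ++ m) [o]).
  { apply Hloop; trivial.
    - apply edge_path_app; trivial; now rewrite El.
    - now rewrite last_app, El. }
  apply (list_sum_homotopic C f) in H; trivial; [|intros; now apply Hedge].
  cbn in H; rewrite path_sum_app, El in H; lra. }
exists (fun x => epsilon (inhabits 0) (Q x)).
intros x y Hx Hxy.
assert (Hq : Q x (epsilon (inhabits 0) (Q x))).
{ apply epsilon_spec; destruct (Hconn o x Ho Hx) as (l & ? & ?).
  eexists; exists l; eauto. }
assert (Hq' : Q y (epsilon (inhabits 0) (Q x) + f x y)).
{ destruct Hq as (l & Hl & El & ->).
  exists (l ++ [y]); repeat split.
  - apply edge_path_app; trivial; rewrite El; cbn; auto.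
  - now rewrite last_app.
  - rewrite path_sum_app, El; cbn; ring. }
apply (HQ y); trivial; apply epsilon_spec; eauto.
Qed.

Lemma lattice_potential (C : complex) (a b : vertex -> R) :
  simply_connected C ->
  (forall x y, cedge C x y -> cvert C y /\ cedge C y x /\ lattice_step x y) ->
  (forall s, cface C s -> a s + b (east s) = b s + a (north s)) ->
  exists h : vertex -> R, forall x y, cvert C x -> cedge C x y ->
    h y = h x + increment a b x y.
Proof.
intros HC Hedge Hface.
apply (potential C (increment a b)); trivial.
- intros x y H; destruct (Hedge _ _ H) as (? & ? & ?); auto using increment_opp.
- intros x y z w [(s & Hs & HP) (Hxy & Hyz & Hzw & Hwx)].
  (* With the local primitive [g], both ways around the face telescope to [g z - g x]. *)
  destruct (increment_square a b s (Hface s Hs)) as [g Hg].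
  assert (Hin : forall p, In p [x; y; z; w] -> In p (corners s))
    by (intros p; apply Permutation_in, HP).
  cbn [In] in Hin.
  apply Hedge in Hzw as (_ & Hwz & _); apply Hedge in Hwx as (_ & Hxw & _).
  apply Hedge in Hxy as (_ & _ & Hxy); apply Hedge in Hyz as (_ & _ & Hyz).
  apply Hedge in Hxw as (_ & _ & Hxw); apply Hedge in Hwz as (_ & _ & Hwz).
  rewrite !Hg by auto 6; ring.
Qed.

(** * Edges, squares and pinched vertices *)

Definition square_edge (s v w : vertex) : Prop :=
  In (v, w) [(s, east s); (s, north s); (north s, north (east s));
             (east s, north (east s))].

(** Frames and touching points belong to squares, so an argument about an edge first picks a square
    of [G] that contains it. *)
Lemma adj_square (G : vertex -> bool) (v w : vertex) :
  adj G v w <-> exists s, G s = true /\ (square_edge s v w \/ square_edge s w v).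
Proof.
unfold adj, neighbors; rewrite !in_app_iff; split.
- unfold edge_h, edge_v, square_edge.
  assert (Horb : forall (b c : bool) x,
    In w (if (b || c)%bool then [x] else []) -> (b = true \/ c = true) /\ x = w).
  { intros [|] [|] x; cbn; intuition. }
  intros [H | [H | [H | H]]]; apply Horb in H as [[H | H] <-].
  + exists v; cbn; auto.
  + exists (south v); split; trivial; left.
    change (north (east (south v))) with (east (north (south v))).
    rewrite north_south; cbn; auto.
  + exists v; cbn; auto.
  + exists (west v); split; trivial; left.
    rewrite east_west; cbn; auto.
  + exists (west v); split; trivial; right; rewrite east_west; cbn; auto.
  + exists (south (west v)); split; trivial; right.
    change (north (east (south (west v)))) with (east (north (south (west v)))).
    rewrite north_south, east_west; cbn; auto.
  + exists (south v); split; trivial; right; rewrite north_south; cbn; auto.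
  + exists (west (south v)); split; trivial; right.
    rewrite east_west, north_south; cbn; auto.
- intros (s & Hs & H).
  assert (E1 : edge_h G s = true) by (unfold edge_h; now rewrite Hs).
  assert (E2 : edge_v G s = true) by (unfold edge_v; now rewrite Hs).
  assert (E3 : edge_h G (north s) = true)
    by (unfold edge_h; rewrite south_north, Hs; apply Bool.orb_true_r).
  assert (E4 : edge_v G (east s) = true)
    by (unfold edge_v; rewrite west_east, Hs; apply Bool.orb_true_r).
  unfold square_edge in H; cbn [In] in H.
  destruct H as [[H|[H|[H|[H|[]]]]]|[H|[H|[H|[H|[]]]]]]; injection H as <- <-.
  + left; rewrite E1; now left.
  + right; left; rewrite E2; now left.
  + left; rewrite E3; now left.
  + right; left; rewrite E4; now left.
  + right; right; left; rewrite west_east, E1; now left.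
  + right; right; right; rewrite south_north, E2; now left.
  + right; right; left; change (north (east s)) with (east (north s)).
    rewrite west_east, E3; now left.
  + right; right; right; rewrite south_north, E4; now left.
Qed.

Lemma primal_edge (G : vertex -> bool) (x y : vertex) :
  cedge (primal G) x y ->
  cvert (primal G) y /\ cedge (primal G) y x /\ lattice_step x y.
Proof.
cbn; intros H; split; [|split].
- apply adj_square in H as (s & Hs & [H | H]); exists s; split; trivial;
  destruct H as [H|[H|[H|[H|[]]]]]; injection H as <- <-; cbn; auto.
- apply adj_square in H as (s & Hs & H); apply adj_square; exists s; tauto.
- unfold adj, neighbors in H; rewrite !in_app_iff in H.
  destruct H as [H | [H | [H | H]]];
  match type of H with context [if ?b then _ else _] => destruct b end;
  destruct H as [<- | []] || destruct H; cbn; auto.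
Qed.

Lemma dual_edge (G : vertex -> bool) (x y : vertex) :
  cedge (dual G) x y ->
  cvert (dual G) y /\ cedge (dual G) y x /\ lattice_step x y.
Proof.
cbn -[In]; intros (Hx & Hy & H); split; [|split; [split; [|split]|]]; trivial.
destruct H as [<- | [<- | [<- | [<- | []]]]]; cbn;
rewrite ?west_east, ?south_north, ?east_west, ?north_south; auto.
Qed.

(** * Absence of pinched vertices *)

Definition vertex_eq_dec (x y : vertex) : {x = y} + {x <> y}.
Proof. decide equality; apply Z.eq_dec. Defined.

(** The boundary of a square is a 4-cycle, which stays connected when one vertex is deleted. *)
Lemma constant_on_square (G : vertex -> bool) (h : vertex -> R) (v s p q : vertex) :
  (forall x y, adj G x y -> x <> v -> y <> v -> h y = h x) ->
  G s = true -> In p (corners s) -> In q (corners s) -> p <> v -> q <> v ->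
  h p = h q.
Proof.
intros H Hs.
assert (Hadj : forall x y, square_edge s x y -> x <> v -> y <> v -> h y = h x).
{ intros x y Hxy; apply H, adj_square; eauto. }
assert (H1 := Hadj s (east s) ltac:(cbn; auto)).
assert (H2 := Hadj s (north s) ltac:(cbn; auto)).
assert (H3 := Hadj (north s) (north (east s)) ltac:(cbn; auto)).
assert (H4 := Hadj (east s) (north (east s)) ltac:(cbn; auto 6)).
(* Opposite corners are distinct, so [v] cannot be both of them; deleting two opposite corners would
   disconnect the cycle. *)
assert (D1 : east s <> north s)
  by (destruct s; unfold east, north; cbn; intros D; inversion D; lia).
assert (D2 : s <> north (east s))
  by (destruct s; unfold east, north; cbn; intros D; inversion D; lia).
clear H Hadj Hs.
intros Hp Hq Np Nq; unfold corners in *.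
generalize dependent (east s); intros e.
generalize dependent (north s); intros n.
generalize dependent (north e); intros ne; intros.
destruct Hp as [<- | [<- | [<- | [<- | []]]]];
destruct Hq as [<- | [<- | [<- | [<- | []]]]]; trivial;
destruct (vertex_eq_dec s v), (vertex_eq_dec e v), (vertex_eq_dec ne v),
  (vertex_eq_dec n v); try contradiction; try congruence;
repeat match goal with Hi : ?A -> _, K : ?A |- _ => specialize (Hi K) end; congruence.
Qed.

(** Consecutive squares of a dual path share an edge, and each edge has an end
    different from [v]. *)
Lemma constant_off_vertex (G : vertex -> bool) (h : vertex -> R) (v s s' p q : vertex) :
  simply_connected (dual G) ->
  (forall x y, adj G x y -> x <> v -> y <> v -> h y = h x) ->
  G s = true -> G s' = true -> In p (corners s) -> In q (corners s') ->
  p <> v -> q <> v -> h p = h q.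
Proof.
intros [Hconn _] H Hs Hs'.
destruct (Hconn s s' Hs Hs') as (l & Hl & <-); clear Hconn Hs'.
revert s p Hs Hl; induction l as [|s' l IH]; intros s p Hs.
- intros _; cbn [last]; apply constant_on_square with G; trivial.
- intros [(_ & Hs' & Hst) Hl] Hp Hq Hpv Hqv.
  rewrite last_cons in Hq.
  assert (Hshare : exists m, In m (corners s) /\ In m (corners s') /\ m <> v).
  { assert (Hn : forall x, x <> north x /\ x <> east x).
    { intros [m n]; unfold east, north; cbn; split; intros D; inversion D; lia. }
    assert (Htwo : forall m m', m <> m' ->
      In m (corners s) -> In m (corners s') ->
      In m' (corners s) -> In m' (corners s') ->
      exists m, In m (corners s) /\ In m (corners s') /\ m <> v).
    { intros m m' Hm; destruct (vertex_eq_dec m v) as [-> |]; eauto 6. }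
    destruct Hst as [<- | [<- | [<- | [<- | []]]]].
    - apply (Htwo (east s) (north (east s))); try apply Hn; cbn; auto.
    - apply (Htwo (north s) (east (north s))); try apply Hn; cbn; auto.
    - apply (Htwo s (north s)); try apply Hn; unfold corners;
        rewrite ?east_west; cbn; auto.
    - apply (Htwo s (east s)); try apply Hn; unfold corners;
        change (north (east (south s))) with (east (north (south s)));
        rewrite ?north_south; cbn; auto. }
  destruct Hshare as (m & Hm & Hm' & Hmv).
  transitivity (h m).
  + apply constant_on_square with G v s; trivial.
  + apply (IH s'); trivial.
Qed.

(** The potential of the cochain is constant off [v]. *)
Lemma increment_at_vertex (G : vertex -> bool) (a b : vertex -> R) (v p q : vertex) :
  simply_connected (primal G) -> simply_connected (dual G) ->
  (forall x y, x <> v -> y <> v -> lattice_step x y -> increment a b x y = 0) ->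
  (forall s, G s = true -> a s + b (east s) = b s + a (north s)) ->
  adj G v p -> adj G v q -> increment a b v p = increment a b v q.
Proof.
intros HP HD Hoff Hclosed Hp Hq.
destruct (lattice_potential _ a b HP (primal_edge G) Hclosed) as [h Hh].
cbn in Hh.
assert (Hv : in_V G v).
{ destruct (primal_edge G v p Hp) as (_ & H & _).
  now destruct (primal_edge G _ _ H). }
enough (h p = h q) by (rewrite (Hh v p), (Hh v q) in *; trivial; lra).
assert (Hsq : forall r, adj G v r ->
  r <> v /\ exists s, G s = true /\ In r (corners s)).
{ intros r Hr; split.
  - destruct (primal_edge G v r Hr) as (_ & _ & Hst).
    destruct v; destruct Hst as [<- | [<- | [<- | [<- | []]]]];
    unfold east, north, west, south; cbn; intros D; inversion D; lia.
  - destruct (primal_edge G v r Hr) as ((s & Hs) & _); eauto. }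
destruct (Hsq p Hp) as (Npv & s & Hs & Hps).
destruct (Hsq q Hq) as (Nqv & s' & Hs' & Hqs).
apply (constant_off_vertex G h v s s'); trivial.
intros x y Hxy Hx Hy.
destruct (primal_edge G x y Hxy) as (_ & Hyx & Hst).
rewrite (Hh x y), (Hoff x y); trivial; [ring|].
now destruct (primal_edge G _ _ Hyx).
Qed.

(** If only two opposite squares around [v] are in [G], the cochain counting
    the passages from [v] into the first of them is closed. *)
Lemma no_pinch_NE_SW (G : vertex -> bool) (v : vertex) :
  simply_connected (primal G) -> simply_connected (dual G) ->
  G v = true -> G (west (south v)) = true ->
  G (west v) = false -> G (south v) = false -> False.
Proof.
intros HP HD H1 H3 H2 H4.
(* The value is 1 on the edges from [v] to [east v] and [north v]. The square [v] has both of them;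
   the squares with just one of them, [west v] and [south v], are missing. *)
pose (a x := if vertex_eq_dec x v then 1 else 0).
assert (E : increment a a v (east v) = increment a a v (west v)).
{ apply (increment_at_vertex G); trivial.
  - intros x y Hx Hy [<- | [<- | [<- | [<- | []]]]];
    rewrite ?increment_east, ?increment_north, ?increment_west, ?increment_south;
    unfold a; destruct (vertex_eq_dec _ v); try congruence; ring.
  - intros s Hs; unfold a.
    destruct (vertex_eq_dec (east s) v) as [<- |].
    { rewrite west_east in H2; congruence. }
    destruct (vertex_eq_dec (north s) v) as [<- |].
    { rewrite south_north in H4; congruence. }
    ring.
  - apply adj_square; exists v; unfold square_edge; cbn; auto.
  - apply adj_square; exists (west (south v)); split; trivial; right.
    unfold square_edge.
    change (north (west (south v))) with (west (north (south v))).
    change (north (east (west (south v)))) with (east (west (north (south v)))).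
    rewrite !north_south, !east_west; cbn; auto. }
(* The equality [E] now says [1 = 0]. *)
rewrite increment_east, increment_west in E; unfold a in E.
destruct (vertex_eq_dec v v); [|congruence].
destruct (vertex_eq_dec (west v) v) as [D|]; [|lra].
destruct v; unfold west in D; inversion D; lia.
Qed.

Lemma no_pinch_NW_SE (G : vertex -> bool) (v : vertex) :
  simply_connected (primal G) -> simply_connected (dual G) ->
  G (west v) = true -> G (south v) = true ->
  G v = false -> G (west (south v)) = false -> False.
Proof.
intros HP HD H2 H4 H1 H3.
(* Passages from [v] into the north-west square now use the edges to [west v] and [north v]. The
   first one runs against the eastward direction, hence the value -1. *)
pose (a x := if vertex_eq_dec (east x) v then -1 else 0).
pose (b x := if vertex_eq_dec x v then 1 else 0).
assert (E : increment a b v (west v) = increment a b v (east v)).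
{ apply (increment_at_vertex G); trivial.
  - intros x y Hx Hy [<- | [<- | [<- | [<- | []]]]];
    rewrite ?increment_east, ?increment_north, ?increment_west, ?increment_south;
    unfold a, b; rewrite ?east_west; destruct (vertex_eq_dec _ v); try congruence; ring.
  - intros s Hs; unfold a, b.
    destruct (vertex_eq_dec s v) as [-> |]; [congruence|].
    destruct (vertex_eq_dec (east (north s)) v) as [<- |].
    { change (south (east (north s))) with (south (north (east s))) in H3.
      rewrite south_north, west_east in H3; congruence. }
    destruct (vertex_eq_dec (east s) v); ring.
  - apply adj_square; exists (west v); split; trivial; right.
    unfold square_edge; rewrite east_west; cbn; auto.
  - apply adj_square; exists (south v); split; trivial; left.
    unfold square_edge.
    change (north (east (south v))) with (east (north (south v))).
    rewrite !north_south; cbn; auto. }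
rewrite increment_east, increment_west in E; unfold a in E.
rewrite east_west in E.
destruct (vertex_eq_dec v v); [|congruence].
destruct (vertex_eq_dec (east v) v) as [D|].
2:{ destruct (vertex_eq_dec (east v) v); [contradiction|lra]. }
destruct v; unfold east in D; inversion D; lia.
Qed.

(** * Frames at touching points *)

(** The point [p + (x + i y) exp (i t)]. *)
Definition offset (p : point) (x y t : R) : point :=
  (fst p + (x * cos t - y * sin t), snd p + (x * sin t + y * cos t)).

(** Congruence modulo [2 PI], in the form that rewrites directly inside [offset]. *)
Definition same_angle (t t' : R) : Prop := cos t = cos t' /\ sin t = sin t'.

Lemma sqr_cos_sin (t : R) : cos t * cos t + sin t * sin t = 1.
Proof. pose proof (sin2_cos2 t); unfold Rsqr in *; lra. Qed.

Lemma offset_0 (p : point) (t : R) : offset p 0 0 t = p.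
Proof. destruct p; unfold offset; cbn; f_equal; ring. Qed.

Lemma offset_offset (p : point) (a b a' b' t : R) :
  offset (offset p a b t) a' b' t = offset p (a + a') (b + b') t.
Proof. unfold offset; cbn; f_equal; ring. Qed.

Lemma offset_PI (p : point) (a b t : R) :
  offset p a b (t + PI) = offset p (- a) (- b) t.
Proof. unfold offset; rewrite neg_cos, neg_sin; f_equal; ring. Qed.

Lemma offset_coordinates (p q : point) (t : R) : exists a b, q = offset p a b t.
Proof.
exists ((fst q - fst p) * cos t + (snd q - snd p) * sin t),
  ((snd q - snd p) * cos t - (fst q - fst p) * sin t).
destruct q as [x y]; unfold offset; cbn.
f_equal.
- transitivity (fst p + (x - fst p) * (cos t * cos t + sin t * sin t));
    [rewrite sqr_cos_sin|]; ring.
- transitivity (snd p + (y - snd p) * (cos t * cos t + sin t * sin t));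
    [rewrite sqr_cos_sin|]; ring.
Qed.

Lemma offset_rebase (x p q : point) (a b a' b' t : R) :
  p = offset x a b t -> q = offset x a' b' t -> q = offset p (a' - a) (b' - b) t.
Proof. intros -> ->; rewrite offset_offset; f_equal; ring. Qed.

Lemma cos_sin_surj (c s : R) : c * c + s * s = 1 -> exists t, c = cos t /\ s = sin t.
Proof.
intros H; assert (Hc : -1 <= c <= 1) by nra.
assert (Hcos := cos_acos c Hc).
assert (Hs := sqr_cos_sin (acos c)); rewrite Hcos in Hs.
assert (Hs' : (s - sin (acos c)) * (s + sin (acos c)) = 0) by nra.
apply Rmult_integral in Hs' as [Hs' | Hs'].
- exists (acos c); split; lra.
- exists (- acos c); rewrite cos_neg, sin_neg; split; lra.
Qed.

(** * Distances, orientations and right triangles in a frame *)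

Lemma distp_sqr (p q : point) :
  distp p q * distp p q =
  (fst p - fst q) * (fst p - fst q) + (snd p - snd q) * (snd p - snd q).
Proof.
unfold distp, dist_euc; rewrite sqrt_sqrt; [unfold Rsqr; ring|].
pose proof (Rle_0_sqr (fst p - fst q)); pose proof (Rle_0_sqr (snd p - snd q)); lra.
Qed.

Lemma distp_ge0 (p q : point) : 0 <= distp p q.
Proof. apply sqrt_pos. Qed.

Lemma distp_offset_sqr (p : point) (a b a' b' t : R) :
  distp (offset p a b t) (offset p a' b' t) * distp (offset p a b t) (offset p a' b' t) =
  (a - a') * (a - a') + (b - b') * (b - b').
Proof.
rewrite distp_sqr; unfold offset; cbn.
transitivity (((a - a') * (a - a') + (b - b') * (b - b')) *
  (cos t * cos t + sin t * sin t)); [ring|rewrite sqr_cos_sin; ring].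
Qed.

Lemma sqr_Rabs (x : R) : Rabs x * Rabs x = x * x.
Proof. rewrite <- Rabs_mult; apply Rabs_right; nra. Qed.

Lemma distp_unique (p q : point) (d : R) :
  0 <= d -> distp p q * distp p q = d * d -> distp p q = d.
Proof. pose proof (distp_ge0 p q); intros; nra. Qed.

Lemma orient_offset (p : point) (a1 b1 a2 b2 a3 b3 t : R) :
  orient (offset p a1 b1 t) (offset p a2 b2 t) (offset p a3 b3 t) =
  (a2 - a1) * (b3 - b1) - (b2 - b1) * (a3 - a1).
Proof.
unfold orient, offset; cbn.
transitivity (((a2 - a1) * (b3 - b1) - (b2 - b1) * (a3 - a1)) *
  (cos t * cos t + sin t * sin t)); [ring|rewrite sqr_cos_sin; ring].
Qed.

Lemma distp_offset_origin (p : point) (a b t : R) :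
  distp (offset p a b t) p * distp (offset p a b t) p = a * a + b * b.
Proof.
rewrite <- (offset_0 p t) at 2 4; rewrite distp_offset_sqr; ring.
Qed.

Lemma orient_offset_origin (p : point) (a1 b1 a2 b2 t : R) :
  orient (offset p a1 b1 t) (offset p a2 b2 t) p = a1 * b2 - a2 * b1.
Proof.
rewrite <- (offset_0 p t) at 3; rewrite orient_offset; ring.
Qed.

Lemma polar (p q : point) : 0 < distp p q -> exists t, q = offset p (distp p q) 0 t.
Proof.
intros H; pose proof (distp_sqr p q) as Hd; set (d := distp p q) in *.
destruct (cos_sin_surj ((fst q - fst p) / d) ((snd q - snd p) / d)) as (t & Hc & Hs).
{ replace 1 with (d * d / (d * d)) by (field; lra). rewrite Hd at 1; field; lra. }
exists t; destruct q as [x y]; unfold offset; rewrite <- Hc, <- Hs; cbn.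
f_equal; field; lra.
Qed.

Lemma sgn_pos_mul (b x : R) : 0 < b -> sgn (b * x) = sgn x.
Proof.
intros Hb; unfold sgn.
destruct (Rlt_dec 0 (b * x)), (Rlt_dec 0 x), (Rlt_dec (b * x) 0), (Rlt_dec x 0);
  trivial; nra.
Qed.

Lemma sgn_sqr_inj (x y : R) : sgn x = sgn y -> x * x = y * y -> x = y.
Proof.
intros Hs H; assert (Hp : (x - y) * (x + y) = 0) by nra.
apply Rmult_integral in Hp as [Hp | Hp]; [lra|].
unfold sgn in Hs; destruct (Rlt_dec 0 x), (Rlt_dec 0 y), (Rlt_dec x 0), (Rlt_dec y 0); lra.
Qed.

(** The right angle of the triangle [A], [B], [x] is at [x]. *)
Lemma leg_of_left (A B x : point) (a b t : R) :
  0 < b -> B = offset x (- b) 0 t ->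
  distp A x = Rabs a -> distp A B * distp A B = a * a + b * b ->
  sgn (orient A B x) = sgn a -> A = offset x 0 a t.
Proof.
intros Hb EB Hx HB Hs.
destruct (offset_coordinates x A t) as (al & be & EA).
rewrite EA, EB in *.
rewrite orient_offset_origin in Hs; rewrite distp_offset_sqr in HB.
assert (Hx2 := distp_offset_origin x al be t); rewrite Hx, sqr_Rabs in Hx2.
assert (Ha : al = 0) by nra.
subst al; f_equal; apply sgn_sqr_inj; [|nra].
rewrite <- Hs, <- (sgn_pos_mul b) by trivial; f_equal; ring.
Qed.

(** Mirror image of [leg_of_left], with [B] on the positive half of the axis. Comparing squared
    distances shows that [A] has no component along the axis; the orientation then fixes the sign of
    its other coordinate. *)
Lemma leg_of_right (A B x : point) (a b t : R) :
  0 < b -> B = offset x b 0 t ->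
  distp A x = Rabs a -> distp A B * distp A B = a * a + b * b ->
  sgn (orient B A x) = sgn a -> A = offset x 0 a t.
Proof.
intros Hb EB Hx HB Hs.
destruct (offset_coordinates x A t) as (al & be & EA).
rewrite EA, EB in *.
rewrite orient_offset_origin in Hs; rewrite distp_offset_sqr in HB.
assert (Hx2 := distp_offset_origin x al be t); rewrite Hx, sqr_Rabs in Hx2.
assert (Ha : al = 0) by nra.
subst al; f_equal; apply sgn_sqr_inj; [|nra].
rewrite <- Hs, <- (sgn_pos_mul b) by trivial; f_equal; ring.
Qed.

Lemma orthogonal_distp (p q : point) (a b : R) :
  orthogonal p a q b -> distp p q * distp p q = a * a + b * b.
Proof.
intros (x & Hp & Hq & H).
rewrite <- (sqr_Rabs a), <- (sqr_Rabs b), <- Hp, <- Hq, !distp_sqr; lra.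
Qed.

Lemma distp_orthogonal (p q : point) (a b : R) :
  0 < a * a + b * b -> distp p q * distp p q = a * a + b * b -> orthogonal p a q b.
Proof.
intros H0 H; pose proof (distp_ge0 p q).
destruct (polar p q) as [t Ht]; [nra|].
set (d := distp p q) in *; assert (Hd : d <> 0) by nra.
(* The apex of the right triangle over the hypotenuse from [p] to [q]: its altitude has length
   [|a b| / d] and its foot is at distance [a^2 / d] from [p]. *)
exists (offset p (a * a / d) (a * b / d) t).
split; [|split].
- apply distp_unique; [apply Rabs_pos|]; rewrite sqr_Rabs.
  rewrite <- (offset_0 p t) at 1 3; rewrite distp_offset_sqr.
  transitivity (a * a * (a * a + b * b) / (d * d)); [|rewrite <- H]; field; trivial.
- apply distp_unique; [apply Rabs_pos|]; rewrite sqr_Rabs, Ht, distp_offset_sqr.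
  transitivity (d * d - 2 * (a * a) + a * a * (a * a + b * b) / (d * d));
    [|rewrite <- H; field_simplify; trivial; lra]; field; trivial.
- rewrite Ht; unfold offset; cbn.
  transitivity ((a * a / d * (a * a / d - d) + a * b / d * (a * b / d)) *
    (cos t * cos t + sin t * sin t)); [ring|].
  transitivity (a * a * ((a * a + b * b) / (d * d) - 1) *
    (cos t * cos t + sin t * sin t)); [field; trivial|].
  rewrite <- H; field; trivial.
Qed.

Lemma rings_orthogonal_distp (K L : ring) : rings_orthogonal K L ->
  distp (center K) (center L) * distp (center K) (center L) =
    inner K * inner K + outer L * outer L /\
  distp (center L) (center K) * distp (center L) (center K) =
    inner L * inner L + outer K * outer K.
Proof.
intros [H1%orthogonal_distp H2%orthogonal_distp].
rewrite (distp_sqr (center L)), (distp_sqr (center K)) in *; lra.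
Qed.

(** The axis runs from the center of [L1] to [x]. Tangency puts the center of [L2] on it beyond [x],
    and orthogonality puts the center of [K] on the perpendicular at [x]. *)
Lemma touch_on_inner_frame (K L1 L2 : ring) (x : point) :
  0 < outer L1 -> 0 < outer L2 -> rings_orthogonal K L1 ->
  touch_on_inner K L1 L2 x ->
  exists t, center K = offset x 0 (inner K) t /\
    center L1 = offset x (- outer L1) 0 t /\ center L2 = offset x (outer L2) 0 t.
Proof.
intros H1 H2 HO (HK & HL1 & HL2 & HT & Hl & _).
unfold on_outer, on_inner, outer_circles_touch in *.
destruct (polar (center L1) x) as [t Ht]; [lra|].
rewrite HL1 in Ht.
assert (E1 : center L1 = offset x (- outer L1) 0 t).
{ rewrite Ht, offset_offset, Rplus_opp_r, Rplus_0_r; symmetry; apply offset_0. }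
exists t; split; [|split; trivial].
- apply leg_of_left with (center L1) (outer L1); trivial.
  now apply rings_orthogonal_distp in HO.
- destruct (offset_coordinates x (center L2) t) as (al & be & E2).
  rewrite E1, E2 in *.
  assert (D1 := distp_offset_origin x al be t); rewrite HL2 in D1.
  assert (D2 := distp_offset_sqr x (- outer L1) 0 al be t); rewrite HT in D2.
  (* The difference of [D2] and [D1], whose terms in [be] cancel. *)
  assert (Ha : outer L1 * (al - outer L2) = 0) by nra.
  apply Rmult_integral in Ha as [Ha | Ha]; [lra|].
  assert (Ha' : al = outer L2) by lra; rewrite Ha' in D1.
  f_equal; trivial; nra.
Qed.

Lemma frame_touch_on_inner (K L1 L2 : ring) (x : point) (t : R) :
  0 < outer L1 -> 0 < outer L2 ->
  center K = offset x 0 (inner K) t ->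
  center L1 = offset x (- outer L1) 0 t -> center L2 = offset x (outer L2) 0 t ->
  touch_on_inner K L1 L2 x.
Proof.
intros H1 H2 EK E1 E2.
unfold touch_on_inner, on_inner, on_outer, outer_circles_touch, left_of, right_of.
rewrite EK, E1, E2, !orient_offset_origin.
repeat split.
1: apply distp_unique; [apply Rabs_pos|]; rewrite sqr_Rabs, distp_offset_origin; ring.
1,2: apply distp_unique; [lra|]; rewrite distp_offset_origin; ring.
1: apply distp_unique; [lra|]; rewrite distp_offset_sqr; ring.
1: rewrite <- (sgn_pos_mul (outer L1) (inner K)) by trivial; f_equal; ring.
rewrite <- (sgn_pos_mul (outer L2) (inner K)) by trivial; f_equal; ring.
Qed.

Lemma touch_on_outer_frame (K L1 L2 : ring) (x : point) :
  0 < outer K -> rings_orthogonal K L1 -> rings_orthogonal K L2 ->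
  touch_on_outer K L1 L2 x ->
  exists t, center K = offset x (outer K) 0 t /\
    center L1 = offset x 0 (inner L1) t /\ center L2 = offset x 0 (- inner L2) t.
Proof.
intros H0 HO1 HO2 (HK & HL1 & HL2 & Hr & Hl).
apply rings_orthogonal_distp in HO1, HO2.
unfold on_outer, on_inner, left_of, right_of in *.
destruct (polar (center K) x) as [t Ht]; [lra|].
rewrite HK in Ht.
assert (EK : center K = offset x (- outer K) 0 t).
{ rewrite Ht, offset_offset, Rplus_opp_r, Rplus_0_r; symmetry; apply offset_0. }
assert (EK' : center K = offset x (outer K) 0 (t + PI)).
{ rewrite EK, offset_PI; f_equal; ring. }
(* The angle [t] points from the center of [K] to [x]; the frame wanted has that center on its
   positive axis. *)
exists (t + PI); split; [|split]; trivial.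
- apply leg_of_right with (center K) (outer K); tauto.
- rewrite offset_PI, Ropp_involutive, Ropp_0.
  apply leg_of_left with (center K) (outer K); tauto.
Qed.

Lemma frame_touch_on_outer (K L1 L2 : ring) (x : point) (t : R) :
  0 < outer K ->
  center K = offset x (outer K) 0 t ->
  center L1 = offset x 0 (inner L1) t -> center L2 = offset x 0 (- inner L2) t ->
  touch_on_outer K L1 L2 x.
Proof.
intros H0 EK E1 E2.
unfold touch_on_outer, on_inner, on_outer, left_of, right_of.
rewrite EK, E1, E2, !orient_offset_origin.
repeat split.
1: apply distp_unique; [lra|]; rewrite distp_offset_origin; ring.
1,2: apply distp_unique; [apply Rabs_pos|]; rewrite sqr_Rabs, distp_offset_origin; ring.
1: rewrite <- (sgn_pos_mul (outer K) (inner L1)) by trivial; f_equal; ring.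
rewrite <- (sgn_pos_mul (outer K) (inner L2)) by trivial; f_equal; ring.
Qed.

(** * Equations satisfied by a pattern *)

Lemma sgn_mul_atan_Rabs (x y : R) : 0 < y -> sgn x * atan (Rabs x / y) = atan (x / y).
Proof.
intros Hy; unfold sgn.
destruct (Rlt_dec 0 x); [rewrite Rabs_right by lra; ring|].
destruct (Rlt_dec x 0).
- rewrite Rabs_left, Rdiv_opp_l, atan_opp by lra; ring.
- replace x with 0 by lra; unfold Rdiv; rewrite Rmult_0_l, Rmult_0_l, atan_0; ring.
Qed.

Lemma sgn_mul_atan_inv (x y : R) : 0 < y -> x <> 0 ->
  sgn x * atan (y / Rabs x) = sgn x * (PI / 2) - atan (x / y).
Proof.
intros Hy Hx; rewrite <- (sgn_mul_atan_Rabs x y) by trivial.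
assert (Ha := Rabs_pos_lt x Hx).
replace (y / Rabs x) with (/ (Rabs x / y)) by (field; lra).
rewrite atan_inv; [ring|]. now apply Rdiv_lt_0_compat.
Qed.

Lemma sinh_neq0 (x : R) : x <> 0 -> sinh x <> 0.
Proof.
intros H; rewrite <- sinh_0.
destruct (Rtotal_order x 0) as [D | [D | D]]; [|contradiction|].
- pose proof (sinh_lt _ _ D); lra.
- pose proof (sinh_lt _ _ D); lra.
Qed.

Lemma sgn_sinh (x : R) : sgn (sinh x) = sgn x.
Proof.
unfold sgn; pose proof sinh_0.
destruct (Rtotal_order x 0) as [D | [-> | D]];
[pose proof (sinh_lt _ _ D)| |pose proof (sinh_lt _ _ D)];
repeat destruct (Rlt_dec _ _); trivial; lra.
Qed.

(** The angle of the first triangle is the complement of the one with tangent [|r_i| / R_j];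
    [turn_atan] combines what remains, and [l0] cancels in the quotients. *)
Lemma phi_turn (l0 : R) (P : vertex -> ring) (rho : vertex -> R) (i j : vertex) :
  0 < l0 -> rho i <> 0 ->
  outer (P i) = l0 * cosh (rho i) /\ inner (P i) = l0 * sinh (rho i) ->
  outer (P j) = l0 * cosh (rho j) /\ inner (P j) = l0 * sinh (rho j) ->
  phi P i j = sgn (rho i) * (PI / 2) - turn (rho i - rho j).
Proof.
intros Hl Hi [Ri ri] [Rj rj]; unfold phi.
pose proof (cosh_pos (rho i)); pose proof (cosh_pos (rho j)).
rewrite sgn_mul_atan_inv, sgn_mul_atan_Rabs; rewrite ?Ri, ?Rj, ?ri, ?rj; try nra.
2: { apply Rmult_integral_contrapositive_currified; [lra|now apply sinh_neq0]. }
rewrite turn_atan, sgn_pos_mul, sgn_sinh by trivial.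
replace (l0 * sinh (rho i) / (l0 * cosh (rho j))) with (sinh (rho i) / cosh (rho j))
  by (field; lra).
replace (l0 * sinh (rho j) / (l0 * cosh (rho i))) with (sinh (rho j) / cosh (rho i))
  by (field; lra).
ring.
Qed.

(** Each summand is [PI / 2 + turn (rho i - rho j)], that is
    [(1 + sgn (rho i)) * (PI / 2) - phi P i j]. The constant is [PI] per neighbor for positive radii
    and 0 for negative ones. *)
Lemma cone_angle_sum (l0 : R) (G : vertex -> bool) (P : vertex -> ring)
    (rho : vertex -> R) (i : vertex) :
  0 < l0 -> in_V G i -> rho_radii l0 G P rho -> rho i <> 0 ->
  Rsum (map (fun j => 2 * atan (exp (rho i - rho j))) (neighbors G i)) =
  INR (Val G i) * ((1 + sgn (rho i)) * (PI / 2)) - cone_angle G P i.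
Proof.
intros Hl Hi Hr Hrho; unfold cone_angle, Val.
assert (Hn : forall j, In j (neighbors G i) -> in_V G j)
  by (intros j Hj; apply (primal_edge G i j Hj)).
induction (neighbors G i) as [|j L IH].
- cbn; ring.
- cbn [map Rsum fold_right]; fold (Rsum (map (phi P i) L)).
  change (length (j :: L)) with (S (length L)); rewrite S_INR.
  rewrite (phi_turn l0 P rho i j) by
    (assumption || (apply Hr; assumption) || (apply Hr, Hn; now left)).
  unfold Rsum in *; rewrite IH by (intros k Hk; apply Hn; now right).
  unfold turn; ring.
Qed.

Lemma inner_neighbors (G : vertex -> bool) (v : vertex) : Val G v = 4%nat ->
  neighbors G v = [east v; north v; west v; south v].
Proof.
unfold Val, neighbors.
destruct (edge_h G v), (edge_v G v), (edge_h G (west v)), (edge_v G (south v));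
cbn; trivial; discriminate.
Qed.

(** Each of the four summands is its turn plus [PI / 2], and these constants add up to [2 * PI]. *)
Lemma inner_sum (G : vertex -> bool) (rho : vertex -> R) (v : vertex) :
  Val G v = 4%nat ->
  Rsum (map (fun j => 2 * atan (exp (rho v - rho j))) (neighbors G v)) = 2 * PI <->
  turn (rho (east v) - rho v) + turn (rho (north v) - rho v) +
  turn (rho (west v) - rho v) + turn (rho (south v) - rho v) = 0.
Proof.
intros Hv; rewrite inner_neighbors by trivial.
assert (E : forall j, turn (rho j - rho v) = - turn (rho v - rho j)).
{ intros j; rewrite <- turn_opp; f_equal; ring. }
rewrite !E; cbn; unfold turn; split; lra.
Qed.

(** * Frames on the two sides of an edge *)

Lemma same_angle_trans (t t' t'' : R) :
  same_angle t t' -> same_angle t' t'' -> same_angle t t''.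
Proof. intros [E1 E2] [E3 E4]; split; congruence. Qed.

Lemma same_angle_plus (t t' a : R) : same_angle t t' -> same_angle (t + a) (t' + a).
Proof. intros [E1 E2]; split; rewrite ?cos_plus, ?sin_plus, E1, E2; trivial. Qed.

Lemma same_angle_offset (p : point) (x y t t' : R) :
  same_angle t t' -> offset p x y t = offset p x y t'.
Proof. intros [E1 E2]; unfold offset; now rewrite E1, E2. Qed.

(** Multiplying by the conjugate [x - i y] isolates the rotation, since [x + i y] is not zero. *)
Lemma offset_angle_inj (p : point) (x y t t' : R) :
  x <> 0 -> offset p x y t = offset p x y t' -> same_angle t t'.
Proof.
intros Hx H; unfold offset in H; injection H as H1 H2.
assert (E1 : x * cos t - y * sin t = x * cos t' - y * sin t') by lra.
assert (E2 : x * sin t + y * cos t = x * sin t' + y * cos t') by lra.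
assert (Hp : x * x + y * y <> 0) by nra.
split; apply Rmult_eq_reg_l with (x * x + y * y); trivial.
- transitivity (x * (x * cos t - y * sin t) + y * (x * sin t + y * cos t)); [ring|].
  rewrite E1, E2; ring.
- transitivity (x * (x * sin t + y * cos t) - y * (x * cos t - y * sin t)); [ring|].
  rewrite E1, E2; ring.
Qed.

(** The same edge seen from the squares on both sides of it: the quadrilateral of
    the two neighboring rings is cyclic, so that the frames of the two squares
    differ by [turn]. *)
Lemma offset_turn (l0 : R) (p : point) (a b t : R) :
  offset p (l0 * cosh b) (l0 * sinh a) t =
  offset p (l0 * cosh a) (l0 * sinh b) (t + turn (a - b)).
Proof.
unfold offset; rewrite cos_plus, sin_plus.
rewrite (cosh_turn a b) at 1 2; rewrite (sinh_turn a b) at 1 2; f_equal; ring.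
Qed.

(** In this and the next three lemmas, [p] is the center of a ring and the edge goes to the named
    neighbor; the formal signs of its coordinates in the frames of the adjacent quadrants depend on
    that direction. *)
Lemma west_turn (l0 : R) (p : point) (a b t t' : R) : 0 < l0 ->
  offset p (l0 * cosh b) (l0 * sinh a) t = offset p (l0 * cosh a) (l0 * sinh b) t' <->
  same_angle t' (t + turn (a - b)).
Proof.
intros Hl; rewrite offset_turn; split; intros H.
- apply (offset_angle_inj p (l0 * cosh a) (l0 * sinh b)); [|easy].
  pose proof (cosh_pos a); nra.
- symmetry; now apply same_angle_offset.
Qed.

Lemma north_turn (l0 : R) (p : point) (a b t t' : R) : 0 < l0 ->
  offset p (l0 * cosh b) (- (l0 * sinh a)) t =
  offset p (l0 * cosh a) (- (l0 * sinh b)) t' <->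
  same_angle t' (t + turn (b - a)).
Proof.
(* Negating both rho-radii flips the second coordinate only, [cosh] being even and [sinh] odd. *)
intros Hl; pose proof (west_turn l0 p (- a) (- b) t t' Hl) as H.
assert (Hc : forall x, cosh (- x) = cosh x)
  by (intros; unfold cosh; rewrite Ropp_involutive; f_equal; ring).
assert (Hs : forall x, sinh (- x) = - sinh x)
  by (intros; unfold sinh; rewrite Ropp_involutive; field).
rewrite !Hc, !Hs, !Ropp_mult_distr_r_reverse in H.
replace (b - a) with (- a - - b) by ring; exact H.
Qed.

Lemma offset_opp_inj (p : point) (x y x' y' t t' : R) :
  offset p (- x) (- y) t = offset p (- x') (- y') t' <->
  offset p x y t = offset p x' y' t'.
Proof.
unfold offset; split; intros H; injection H as H1 H2; f_equal; lra.
Qed.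

Lemma east_turn (l0 : R) (p : point) (a b t t' : R) : 0 < l0 ->
  offset p (- (l0 * cosh b)) (- (l0 * sinh a)) t =
  offset p (- (l0 * cosh a)) (- (l0 * sinh b)) t' <->
  same_angle t' (t + turn (a - b)).
Proof. intros Hl; rewrite offset_opp_inj; now apply west_turn. Qed.

Lemma south_turn (l0 : R) (p : point) (a b t t' : R) : 0 < l0 ->
  offset p (- (l0 * cosh b)) (l0 * sinh a) t =
  offset p (- (l0 * cosh a)) (l0 * sinh b) t' <->
  same_angle t' (t + turn (b - a)).
Proof.
intros Hl; rewrite <- (Ropp_involutive (l0 * sinh a)), <- (Ropp_involutive (l0 * sinh b)).
rewrite offset_opp_inj; now apply north_turn.
Qed.

Lemma rho_radii_outer_pos (l0 : R) (G : vertex -> bool) (P : vertex -> ring)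
    (rho : vertex -> R) (v : vertex) :
  0 < l0 -> rho_radii l0 G P rho -> in_V G v -> 0 < outer (P v).
Proof.
intros Hl Hr Hv; rewrite (proj1 (Hr v Hv)); apply Rmult_lt_0_compat;
auto using cosh_pos.
Qed.

Lemma inner_equation (l0 : R) (G : vertex -> bool) (P : vertex -> ring)
    (rho : vertex -> R) (v : vertex) :
  0 < l0 -> ring_pattern G P -> rho_radii l0 G P rho -> inner_vertex G v ->
  turn (rho (east v) - rho v) + turn (rho (north v) - rho v) +
  turn (rho (west v) - rho v) + turn (rho (south v) - rho v) = 0.
Proof.
intros Hl HP Hr Hv; destruct (pattern_vertex G P HP v Hv)
  as (xse & xne & xnw & xsw & Hse & Hne & Hnw & Hsw & _ & _).
destruct Hv as [Hv HV].
assert (Hn := inner_neighbors G v HV).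
assert (He : adj G v (east v)) by (unfold adj; rewrite Hn; cbn; auto).
assert (Hno : adj G v (north v)) by (unfold adj; rewrite Hn; cbn; auto).
assert (Hw : adj G v (west v)) by (unfold adj; rewrite Hn; cbn; auto).
assert (Hs : adj G v (south v)) by (unfold adj; rewrite Hn; cbn; auto).
assert (HO := pattern_orthogonal G P HP v).
assert (Hpos : forall w, adj G v w -> in_V G w /\ 0 < outer (P w)).
{ intros w Hvw; assert (in_V G w) by apply (primal_edge G v w Hvw).
  eauto using rho_radii_outer_pos. }
assert (HR := rho_radii_outer_pos l0 G P rho v Hl Hr Hv).
destruct (Hr v Hv) as [Rv rv].
destruct (Hpos _ He) as [Ve He']; destruct (Hr _ Ve) as [Re re].
destruct (Hpos _ Hno) as [Vn Hn']; destruct (Hr _ Vn) as [Rn rn].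
destruct (Hpos _ Hw) as [Vw Hw']; destruct (Hr _ Vw) as [Rw rw].
destruct (Hpos _ Hs) as [Vs Hs']; destruct (Hr _ Vs) as [Rs rs].
apply touch_on_inner_frame in Hne as (t1 & K1 & E1 & N1); auto.
apply touch_on_outer_frame in Hnw as (t2 & K2 & N2 & W2); auto.
apply touch_on_inner_frame in Hsw as (t3 & K3 & W3 & S3); auto.
apply touch_on_outer_frame in Hse as (t4 & K4 & S4 & E4); auto.
(* The neighbors are now located from the common center of [P v] instead of four different touching
   points. *)
apply (offset_rebase _ _ _ _ _ _ _ _ K1) in E1, N1.
apply (offset_rebase _ _ _ _ _ _ _ _ K2) in N2, W2.
apply (offset_rebase _ _ _ _ _ _ _ _ K3) in W3, S3.
apply (offset_rebase _ _ _ _ _ _ _ _ K4) in S4, E4.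
set (c := center (P v)) in *; clear K1 K2 K3 K4.
rewrite ?Rv, ?rv, ?Re, ?re, ?Rn, ?rn, ?Rw, ?rw, ?Rs, ?rs in *.
(* At [xnw] and [xsw] the frames found are opposite to those of the lattice squares, hence the
   shifts by [PI]. *)
assert (H12 : same_angle (t2 + PI) (t1 + turn (rho (north v) - rho v))).
{ apply (north_turn l0 c); trivial; rewrite offset_PI.
  transitivity (center (P (north v))); [rewrite N1|rewrite N2]; f_equal; ring. }
assert (H23 : same_angle (t3 + PI) (t2 + PI + turn (rho (west v) - rho v))).
{ apply (west_turn l0 c); trivial; rewrite !offset_PI.
  transitivity (center (P (west v))); [rewrite W2|rewrite W3]; f_equal; ring. }
assert (H34 : same_angle t4 (t3 + PI + turn (rho (south v) - rho v))).
{ apply (south_turn l0 c); trivial; rewrite !offset_PI.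
  transitivity (center (P (south v))); [rewrite S3|rewrite S4]; f_equal; ring. }
assert (H41 : same_angle t1 (t4 + turn (rho (east v) - rho v))).
{ apply (east_turn l0 c); trivial.
  transitivity (center (P (east v))); [rewrite E4|rewrite E1]; f_equal; ring. }
pose proof (turn_bound (rho (east v) - rho v)).
pose proof (turn_bound (rho (north v) - rho v)).
pose proof (turn_bound (rho (west v) - rho v)).
pose proof (turn_bound (rho (south v) - rho v)).
set (e := turn (rho (east v) - rho v)) in *.
set (n := turn (rho (north v) - rho v)) in *.
set (w := turn (rho (west v) - rho v)) in *.
set (s := turn (rho (south v) - rho v)) in *.
apply cos_eq_1_0; [|lra].
(* Composing the four congruences around [v] returns to [t1], so the sum of the turns is 0 modulo
   [2 PI]. *)
apply (same_angle_plus _ _ w) in H12; apply (same_angle_trans _ _ _ H23) in H12.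
apply (same_angle_plus _ _ s) in H12; apply (same_angle_trans _ _ _ H34) in H12.
apply (same_angle_plus _ _ e) in H12; apply (same_angle_trans _ _ _ H41) in H12.
destruct H12 as [Hc Hsn].
replace (e + n + w + s) with (t1 + n + w + s + e - t1) by ring.
rewrite cos_minus, <- Hc, <- Hsn; apply sqr_cos_sin.
Qed.

(** * Uniqueness *)

Definition has_radii (l0 : R) (rho : vertex -> R) (P : vertex -> ring) (v : vertex) : Prop :=
  outer (P v) = l0 * cosh (rho v) /\ inner (P v) = l0 * sinh (rho v).

(** The outer circles at [east s] and [north s] touch along the direction [t]. *)
Definition square_frame (P : vertex -> ring) (s : vertex) (t : R) : Prop :=
  exists x,
    center (P s) = offset x 0 (inner (P s)) t /\
    center (P (east s)) = offset x (- outer (P (east s))) 0 t /\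
    center (P (north (east s))) = offset x 0 (- inner (P (north (east s)))) t /\
    center (P (north s)) = offset x (outer (P (north s))) 0 t.

Lemma pattern_square_frame (l0 : R) (G : vertex -> bool) (P : vertex -> ring)
    (rho : vertex -> R) (s : vertex) :
  0 < l0 -> ring_pattern G P -> rho_radii l0 G P rho -> G s = true ->
  exists t, square_frame P s t.
Proof.
intros Hl HP Hr Hs.
destruct (pattern_square G P HP s Hs) as (x & (A1 & A2 & A3 & A4 & A5) & B1 & B2 & B3 & B4).
assert (Hv : forall v, In v (corners s) -> in_V G v /\ 0 < outer (P v)).
{ intros v Hv; assert (in_V G v) by (exists s; auto).
  eauto using rho_radii_outer_pos. }
assert (He := Hv (east s) ltac:(cbn; auto)).
assert (Hn := Hv (north s) ltac:(cbn; auto)).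
assert (Hne := Hv (north (east s)) ltac:(cbn; auto)).
assert (Hsv := Hv s ltac:(cbn; auto)).
assert (HO : forall v w, square_edge s v w -> in_V G w -> rings_orthogonal (P w) (P v)).
{ intros v w Hvw Hw; apply (pattern_orthogonal G P HP); trivial.
  apply adj_square; eauto. }
destruct (touch_on_inner_frame (P s) (P (east s)) (P (north s)) x) as (t & K & E & N);
  try tauto.
- apply (pattern_orthogonal G P HP); try tauto; apply adj_square; exists s.
  unfold square_edge; cbn; auto.
- unfold touch_on_inner; tauto.
- exists t, x; split; [|split; [|split]]; trivial.
  (* The opposite ring sees the same axis from its other side: its frame is reversed, which gives
     the minus sign. *)
  assert (E' : center (P (north (east s))) =
    offset x 0 (inner (P (north (east s)))) (t + PI)).
  { apply leg_of_left with (center (P (north s))) (outer (P (north s)));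
      [tauto| |assumption| |assumption].
    - rewrite N, offset_PI; f_equal; ring.
    - assert (H := HO (north s) (north (east s)) ltac:(unfold square_edge; cbn; auto)
        ltac:(tauto)).
      now apply rings_orthogonal_distp in H. }
  rewrite E', offset_PI; f_equal; ring.
Qed.

Lemma square_frame_edges (P : vertex -> ring) (s : vertex) (t : R) :
  square_frame P s t ->
  (center (P (east s)) =
    offset (center (P s)) (- outer (P (east s))) (- inner (P s)) t /\
   center (P (north s)) =
    offset (center (P s)) (outer (P (north s))) (- inner (P s)) t) /\
  (center (P (north (east s))) =
    offset (center (P (east s))) (outer (P (east s))) (- inner (P (north (east s)))) t /\
   center (P s) =
    offset (center (P (east s))) (outer (P (east s))) (inner (P s)) t) /\
  (center (P (north s)) =
    offset (center (P (north (east s)))) (outer (P (north s)))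
      (inner (P (north (east s)))) t /\
   center (P (east s)) =
    offset (center (P (north (east s)))) (- outer (P (east s)))
      (inner (P (north (east s)))) t) /\
  (center (P s) =
    offset (center (P (north s))) (- outer (P (north s))) (inner (P s)) t /\
   center (P (north (east s))) =
    offset (center (P (north s))) (- outer (P (north s)))
      (- inner (P (north (east s)))) t).
Proof.
intros (x & E1 & E2 & E3 & E4).
rewrite E1, E2, E3, E4, !offset_offset.
repeat split; f_equal; ring.
Qed.

(** The coordinates are chosen before [P], so two patterns with the same radii share them. The
    symmetric form of the squared length serves both orthogonality conditions of an edge. *)
Lemma square_edge_offset (l0 : R) (rho : vertex -> R) (s v w : vertex) :
  square_edge s v w -> exists a b,
    a * a + b * b = l0 * l0 + l0 * sinh (rho v) * (l0 * sinh (rho v)) +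
                    l0 * sinh (rho w) * (l0 * sinh (rho w)) /\
    forall P t, (forall u, In u (corners s) -> has_radii l0 rho P u) ->
      square_frame P s t -> center (P w) = offset (center (P v)) a b t.
Proof.
assert (Hc : forall x, l0 * cosh x * (l0 * cosh x) = l0 * l0 + l0 * sinh x * (l0 * sinh x)).
{ intros x; transitivity (l0 * l0 * (cosh x * cosh x)); [ring|rewrite cosh_sqr; ring]. }
intros H; unfold square_edge in H; cbn [In] in H.
destruct H as [H | [H | [H | [H | []]]]]; injection H as <- <-.
- exists (- (l0 * cosh (rho (east s)))), (- (l0 * sinh (rho s))); split.
  + rewrite !Rmult_opp_opp, Hc; ring.
  + intros P t Hr Hf.
    destruct (square_frame_edges P s t Hf) as ((E & _) & _).
    rewrite E; f_equal; f_equal; apply Hr; cbn; auto.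
- exists (l0 * cosh (rho (north s))), (- (l0 * sinh (rho s))); split.
  + rewrite !Rmult_opp_opp, Hc; ring.
  + intros P t Hr Hf.
    destruct (square_frame_edges P s t Hf) as ((_ & E) & _).
    rewrite E; f_equal; [|f_equal]; apply Hr; cbn; auto.
- exists (- (l0 * cosh (rho (north s)))), (- (l0 * sinh (rho (north (east s))))); split.
  + rewrite !Rmult_opp_opp, Hc; ring.
  + intros P t Hr Hf.
    destruct (square_frame_edges P s t Hf) as (_ & _ & _ & _ & E).
    rewrite E; f_equal; f_equal; apply Hr; cbn; auto.
- exists (l0 * cosh (rho (east s))), (- (l0 * sinh (rho (north (east s))))); split.
  + rewrite !Rmult_opp_opp, Hc; ring.
  + intros P t Hr Hf.
    destruct (square_frame_edges P s t Hf) as (_ & (E & _) & _).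
    rewrite E; f_equal; [|f_equal]; apply Hr; cbn; auto.
Qed.

Lemma square_frame_east (l0 : R) (rho : vertex -> R) (P : vertex -> ring)
    (s : vertex) (t t' : R) :
  0 < l0 -> (forall u, In u (corners s) -> has_radii l0 rho P u) ->
  square_frame P s t -> square_frame P (east s) t' ->
  same_angle t' (t + turn (rho (east s) - rho (north (east s)))).
Proof.
intros Hl Hr H1 H2.
apply square_frame_edges in H1 as (_ & (E1 & _) & _).
apply square_frame_edges in H2 as ((_ & E2) & _).
destruct (Hr (east s) ltac:(cbn; auto)) as [Re re].
destruct (Hr (north (east s)) ltac:(cbn; auto)) as [Rn rn].
apply (north_turn l0 (center (P (east s)))); trivial.
rewrite <- Re, <- rn, <- Rn, <- re; congruence.
Qed.

Lemma square_frame_north (l0 : R) (rho : vertex -> R) (P : vertex -> ring)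
    (s : vertex) (t t' : R) :
  0 < l0 -> (forall u, In u (corners s) -> has_radii l0 rho P u) ->
  square_frame P s t -> square_frame P (north s) t' ->
  same_angle t' (t + turn (rho (north (east s)) - rho (north s))).
Proof.
intros Hl Hr H1 H2.
apply square_frame_edges in H1 as (_ & _ & _ & _ & E1).
apply square_frame_edges in H2 as ((E2 & _) & _).
destruct (Hr (north s) ltac:(cbn; auto)) as [Re re].
destruct (Hr (north (east s)) ltac:(cbn; auto)) as [Rn rn].
apply (east_turn l0 (center (P (north s)))); trivial.
rewrite <- Re, <- rn, <- Rn, <- re.
change (east (north s)) with (north (east s)) in E2; congruence.
Qed.

Lemma same_angle_sym (t t' : R) : same_angle t t' -> same_angle t' t.
Proof. intros [E1 E2]; split; congruence. Qed.

Lemma pattern_congruent (l0 : R) (G : vertex -> bool) (P Q : vertex -> ring)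
    (rho : vertex -> R) :
  0 < l0 -> simply_connected (primal G) -> simply_connected (dual G) ->
  ring_pattern G P -> ring_pattern G Q ->
  rho_radii l0 G P rho -> rho_radii l0 G Q rho -> congruent G P Q.
Proof.
intros Hl [HG _] [HD _] HP HQ rP rQ.
destruct (excluded_middle_informative (exists s, G s = true)) as [[s0 Hs0] | Hno].
2: { exists (fun p => (cos 0 * fst p - sin 0 * snd p + 0, sin 0 * fst p + cos 0 * snd p + 0)).
  split; [exists 0, 0, 0; reflexivity|].
  intros v (s & Hs & _); destruct Hno; eauto. }
destruct (pattern_square_frame l0 G P rho s0) as [p0 Hp0]; trivial.
destruct (pattern_square_frame l0 G Q rho s0) as [q0 Hq0]; trivial.
(* The rotation angle of the motion sought, read off at one square. *)
set (g := q0 - p0).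
assert (cP : forall s, G s = true -> forall u, In u (corners s) -> has_radii l0 rho P u)
  by (intros s Hs u Hu; apply rP; exists s; auto).
assert (cQ : forall s, G s = true -> forall u, In u (corners s) -> has_radii l0 rho Q u)
  by (intros s Hs u Hu; apply rQ; exists s; auto).
(* The change [d] is quantified before the pattern, so that it is the same for [P] and [Q]. Steps to
   the west and south invert steps to the east and north. *)
assert (Hstep : forall s s', cedge (dual G) s s' ->
  exists d, forall R, ring_pattern G R -> rho_radii l0 G R rho ->
  forall t t', square_frame R s t -> square_frame R s' t' -> same_angle t' (t + d)).
{ intros s s' (Hs & Hs' & Hst).
  assert (c : forall R, rho_radii l0 G R rho ->
    forall s, G s = true -> forall u, In u (corners s) -> has_radii l0 rho R u)
    by (intros R Hr x Hx u Hu; apply Hr; exists x; auto).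
  destruct Hst as [<- | [<- | [<- | [<- | []]]]].
  - exists (turn (rho (east s) - rho (north (east s)))); intros R HR Hr t t'.
    apply square_frame_east with l0; trivial; eauto.
  - exists (turn (rho (north (east s)) - rho (north s))); intros R HR Hr t t'.
    apply square_frame_north with l0; trivial; eauto.
  - exists (- turn (rho (east (west s)) - rho (north (east (west s)))));
    intros R HR Hr t t' Ht Ht'.
    rewrite <- (east_west s) in Ht.
    assert (E := square_frame_east l0 rho R _ _ _ Hl (c R Hr _ Hs') Ht' Ht).
    apply (same_angle_plus _ _ (- turn (rho (east (west s)) - rho (north (east (west s)))))) in E.
    apply same_angle_sym in E; rewrite Rplus_assoc, Rplus_opp_r, Rplus_0_r in E; trivial.
  - exists (- turn (rho (north (east (south s))) - rho (north (south s))));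
    intros R HR Hr t t' Ht Ht'.
    rewrite <- (north_south s) in Ht.
    assert (E := square_frame_north l0 rho R _ _ _ Hl (c R Hr _ Hs') Ht' Ht).
    apply (same_angle_plus _ _ (- turn (rho (north (east (south s))) - rho (north (south s))))) in E.
    apply same_angle_sym in E; rewrite Rplus_assoc, Rplus_opp_r, Rplus_0_r in E; trivial. }
assert (Hg : forall s, G s = true -> forall tP tQ,
  square_frame P s tP -> square_frame Q s tQ -> same_angle tQ (tP + g)).
{ intros s Hs; destruct (HD s0 s Hs0 Hs) as (l & Hpath & <-); clear Hs.
  assert (H0 : forall tP tQ, square_frame P s0 tP -> square_frame Q s0 tQ ->
    same_angle tQ (tP + g)).
  { assert (Hu : forall R, ring_pattern G R -> rho_radii l0 G R rho ->
      forall t t', square_frame R s0 t -> square_frame R s0 t' -> same_angle t t').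
    { intros R HR Hr t t' Ht Ht'.
      apply square_frame_edges in Ht as ((Ht & _) & _).
      apply square_frame_edges in Ht' as ((Ht' & _) & _).
      rewrite Ht in Ht'; apply offset_angle_inj in Ht'; trivial.
      enough (0 < outer (R (east s0))) by lra.
      apply (rho_radii_outer_pos l0 G R rho); trivial; exists s0; cbn; auto. }
    intros tP tQ H1 H2.
    apply same_angle_trans with q0; [apply (Hu Q); trivial|].
    replace q0 with (p0 + g) by (unfold g; ring).
    apply same_angle_plus; apply (Hu P); trivial. }
  clearbody g; clear p0 q0 Hp0 Hq0; revert s0 Hs0 H0 Hpath.
  induction l as [|s l IH]; intros s0 Hs0 H0; trivial.
  intros [Hedge Hpath]; rewrite last_cons.
  apply IH; trivial; [apply Hedge|].
  destruct (Hstep _ _ Hedge) as [d Hd].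
  intros tP tQ H1 H2.
  destruct (pattern_square_frame l0 G P rho s0) as [p0 Hp0]; trivial.
  destruct (pattern_square_frame l0 G Q rho s0) as [q0 Hq0]; trivial.
  apply same_angle_trans with (q0 + d); [apply (Hd Q); trivial|].
  apply same_angle_trans with (p0 + g + d); [now apply same_angle_plus, H0|].
  replace (p0 + g + d) with (p0 + d + g) by ring.
  apply same_angle_plus, same_angle_sym, (Hd P); trivial. }
set (rot := fun p : point =>
  (cos g * fst p - sin g * snd p, sin g * fst p + cos g * snd p) : point).
set (a := fst (center (Q s0)) - fst (rot (center (P s0)))).
set (b := snd (center (Q s0)) - snd (rot (center (P s0)))).
set (m := fun p : point =>
  (cos g * fst p - sin g * snd p + a, sin g * fst p + cos g * snd p + b) : point).
exists m; split; [exists g, a, b; reflexivity|].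
(* The motion carries a frame of angle [t] to one of angle [t + g], so each edge of [P] is mapped to
   that of [Q]. *)
assert (Hm : forall p x y t, offset (m p) x y (t + g) = m (offset p x y t)).
{ intros p x y t; unfold m, offset; cbn; rewrite cos_plus, sin_plus; f_equal; ring. }
assert (Vs0 : in_V G s0) by (exists s0; cbn; auto).
intros v Hv.
enough (Hc : center (Q v) = m (center (P v))).
{ destruct (rP v Hv) as [E1 E2], (rQ v Hv) as [E3 E4].
  rewrite <- Hc, E1, E2, <- E3, <- E4; now destruct (Q v). }
destruct (HG s0 v Vs0 Hv) as (l & Hpath & <-); clear Hv.
assert (H0 : center (Q s0) = m (center (P s0))).
{ unfold m, a, b, rot; destruct (center (Q s0)); cbn; f_equal; ring. }
clearbody m; revert H0 Hpath; clear a b rot Hs0 Hp0 Hq0 Vs0.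
generalize s0; clear s0; induction l as [|w l IH]; intros v Hv; trivial.
intros [Hvw Hpath]; rewrite last_cons; apply IH; trivial.
apply adj_square in Hvw as (s & Hs & Hvw).
destruct (pattern_square_frame l0 G P rho s) as [tP HtP]; trivial.
destruct (pattern_square_frame l0 G Q rho s) as [tQ HtQ]; trivial.
assert (Ht := Hg s Hs _ _ HtP HtQ).
destruct Hvw as [H | H]; apply (square_edge_offset l0 rho) in H as (x & y & _ & H).
- rewrite (H P tP), (H Q tQ), Hv, <- Hm; eauto using same_angle_offset.
(* Here the edge is traversed against its orientation in the square, so the translation is solved
   for its origin. *)
- rewrite (H P tP), (H Q tQ) in Hv; eauto.
  rewrite <- Hm, (same_angle_offset _ _ _ _ _ Ht) in Hv.
  unfold offset in Hv; injection Hv as H1 H2.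
  destruct (center (Q w)), (m (center (P w))); cbn in *; f_equal; lra.
Qed.

(** * Existence *)

Lemma in_direction_offset (p x : point) (d t : R) :
  0 <= d -> x = offset p d 0 t -> in_direction p t x.
Proof.
intros Hd Hx; unfold in_direction.
replace (distp p x) with d.
- rewrite Hx; unfold offset; f_equal; ring.
- symmetry; apply distp_unique; trivial.
  unfold distp; rewrite distance_symm; fold (distp x p).
  rewrite Hx, distp_offset_origin; ring.
Qed.

Lemma offset_PI2 (p : point) (a t : R) :
  offset p a 0 (t + PI / 2) = offset p 0 a t /\
  offset p a 0 (t - PI / 2) = offset p 0 (- a) t.
Proof.
unfold offset; rewrite cos_minus, sin_minus, cos_plus, sin_plus, cos_PI2, sin_PI2.
split; f_equal; ring.
Qed.

(** [t1], [t2], [t3], [t4] are the frames of the four quadrants around [v], from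
    the north-east one on.  It suffices that each edge is given in one of the two
    frames on its sides: hence a missing square is harmless. *)
Lemma star_touching_points (l0 : R) (rho : vertex -> R) (P : vertex -> ring)
    (v : vertex) (t1 t2 t3 t4 : R) :
  0 < l0 ->
  (forall u, In u [v; east v; north v; west v; south v] -> has_radii l0 rho P u) ->
  t2 = t1 + turn (rho (north v) - rho v) ->
  t3 = t2 + turn (rho (west v) - rho v) ->
  t4 = t3 + turn (rho (south v) - rho v) ->
  t1 = t4 + turn (rho (east v) - rho v) ->
  center (P (east v)) =
    offset (center (P v)) (- outer (P (east v))) (- inner (P v)) t1 \/
  center (P (east v)) =
    offset (center (P v)) (- outer (P v)) (- inner (P (east v))) t4 ->
  center (P (north v)) =
    offset (center (P v)) (outer (P (north v))) (- inner (P v)) t1 \/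
  center (P (north v)) =
    offset (center (P v)) (outer (P v)) (- inner (P (north v))) t2 ->
  center (P (west v)) =
    offset (center (P v)) (outer (P v)) (inner (P (west v))) t2 \/
  center (P (west v)) =
    offset (center (P v)) (outer (P (west v))) (inner (P v)) t3 ->
  center (P (south v)) =
    offset (center (P v)) (- outer (P (south v))) (inner (P v)) t3 \/
  center (P (south v)) =
    offset (center (P v)) (- outer (P v)) (inner (P (south v))) t4 ->
  exists se ne nw sw : point,
    touch_on_outer (P v) (P (south v)) (P (east v)) se /\
    touch_on_inner (P v) (P (east v)) (P (north v)) ne /\
    touch_on_outer (P v) (P (north v)) (P (west v)) nw /\
    touch_on_inner (P v) (P (west v)) (P (south v)) sw /\
    (inner (P v) > 0 -> ccw_order (center (P v)) se ne nw sw) /\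
    (inner (P v) < 0 -> ccw_order (center (P v)) sw nw ne se).
Proof.
intros Hl Hr T2 T3 T4 T1 HE HN HW HS.
assert (Hpos : forall u, In u [v; east v; north v; west v; south v] -> 0 < outer (P u)).
{ intros u Hu; rewrite (proj1 (Hr u Hu)); apply Rmult_lt_0_compat; auto using cosh_pos. }
assert (Pv := Hpos v ltac:(cbn; auto)).
assert (Pe := Hpos (east v) ltac:(cbn; auto)).
assert (Pn := Hpos (north v) ltac:(cbn; auto)).
assert (Pw := Hpos (west v) ltac:(cbn; auto)).
assert (Ps := Hpos (south v) ltac:(cbn; auto 6)).
destruct (Hr v ltac:(cbn; auto)) as [Rv rv].
destruct (Hr (east v) ltac:(cbn; auto)) as [Re re].
destruct (Hr (north v) ltac:(cbn; auto)) as [Rn rn].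
destruct (Hr (west v) ltac:(cbn; auto)) as [Rw rw].
destruct (Hr (south v) ltac:(cbn; auto 6)) as [Rs rs].
set (c := center (P v)) in *.
assert (S2 : same_angle t2 (t1 + turn (rho (north v) - rho v))) by (rewrite T2; now split).
assert (S3 : same_angle t3 (t2 + turn (rho (west v) - rho v))) by (rewrite T3; now split).
assert (S4 : same_angle t4 (t3 + turn (rho (south v) - rho v))) by (rewrite T4; now split).
assert (S1 : same_angle t1 (t4 + turn (rho (east v) - rho v))) by (rewrite T1 at 1; now split).
apply (north_turn l0 c) in S2; trivial; apply (west_turn l0 c) in S3; trivial.
apply (south_turn l0 c) in S4; trivial; apply (east_turn l0 c) in S1; trivial.
rewrite <- Rv, <- rv, <- Rn, <- rn in S2; rewrite <- Rv, <- rv, <- Rw, <- rw in S3.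
rewrite <- Rv, <- rv, <- Rs, <- rs in S4; rewrite <- Rv, <- rv, <- Re, <- re in S1.
(* The two alternatives for each edge become the same equation. *)
rewrite <- S1 in HE; rewrite S2 in HN; rewrite <- S3 in HW; rewrite S4 in HS.
assert (E4 : center (P (east v)) = offset c (- outer (P v)) (- inner (P (east v))) t4) by tauto.
assert (N2 : center (P (north v)) = offset c (outer (P v)) (- inner (P (north v))) t2) by tauto.
assert (W2 : center (P (west v)) = offset c (outer (P v)) (inner (P (west v))) t2) by tauto.
assert (So4 : center (P (south v)) = offset c (- outer (P v)) (inner (P (south v))) t4) by tauto.
assert (E1 := eq_trans E4 S1); assert (N1 := eq_trans N2 (eq_sym S2)).
assert (W3 := eq_trans W2 S3); assert (So3 := eq_trans So4 (eq_sym S4)).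
clear HE HN HW HS S1 S2 S3 S4.
exists (offset c (- outer (P v)) 0 t4), (offset c 0 (- inner (P v)) t1),
  (offset c (outer (P v)) 0 t2), (offset c 0 (inner (P v)) t3).
assert (Ec : forall a b a' b' t, a + a' = 0 -> b + b' = 0 ->
  c = offset (offset c a b t) a' b' t).
{ intros a b a' b' t Ha Hb; rewrite offset_offset, Ha, Hb; symmetry; apply offset_0. }
split; [|split; [|split; [|split; [|split]]]].
- apply frame_touch_on_outer with t4; trivial.
  + fold c; apply Ec; ring.
  + rewrite So4, offset_offset; f_equal; ring.
  + rewrite E4, offset_offset; f_equal; ring.
- apply frame_touch_on_inner with t1; trivial.
  + fold c; apply Ec; ring.
  + rewrite E1, offset_offset; f_equal; ring.
  + rewrite N1, offset_offset; f_equal; ring.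
- apply frame_touch_on_outer with (t2 + PI); trivial; rewrite offset_PI.
  + fold c; apply Ec; ring.
  + rewrite N2, offset_offset; f_equal; ring.
  + rewrite W2, offset_offset; f_equal; ring.
- apply frame_touch_on_inner with (t3 + PI); trivial; rewrite offset_PI.
  + fold c; apply Ec; ring.
  + rewrite W3, offset_offset; f_equal; ring.
  + rewrite So3, offset_offset; f_equal; ring.
- intros Hpos'; pose proof (turn_bound (rho (east v) - rho v)).
  pose proof (turn_bound (rho (north v) - rho v)).
  pose proof (turn_bound (rho (west v) - rho v)).
  pose proof (turn_bound (rho (south v) - rho v)).
  (* The cyclic gaps are [PI / 2] plus the turns at east, north, west and south, hence positive. *)
  exists (t4 - PI), (t1 - PI / 2), t2, (t3 + PI / 2).
  do 4 (split; [lra|]); repeat split.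
  + apply in_direction_offset with (outer (P v)); [lra|].
    replace t4 with (t4 - PI + PI) at 1 by ring; rewrite offset_PI; f_equal; ring.
  + apply in_direction_offset with (inner (P v)); [lra|].
    symmetry; apply offset_PI2.
  + apply in_direction_offset with (outer (P v)); [lra|reflexivity].
  + apply in_direction_offset with (inner (P v)); [lra|].
    symmetry; apply offset_PI2.
- intros Hneg; pose proof (turn_bound (rho (east v) - rho v)).
  pose proof (turn_bound (rho (north v) - rho v)).
  pose proof (turn_bound (rho (west v) - rho v)).
  pose proof (turn_bound (rho (south v) - rho v)).
  (* A negative inner radius reverses the directions of [ne] and [sw]; the gaps are now [PI / 2]
     minus the turns. *)
  exists (t3 - PI / 2), t2, (t1 + PI / 2), (t4 + PI).
  do 4 (split; [lra|]); repeat split.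
  + apply in_direction_offset with (- inner (P v)); [lra|].
    rewrite (proj2 (offset_PI2 _ _ _)), Ropp_involutive; reflexivity.
  + apply in_direction_offset with (outer (P v)); [lra|reflexivity].
  + apply in_direction_offset with (- inner (P v)); [lra|].
    symmetry; apply offset_PI2.
  + apply in_direction_offset with (outer (P v)); [lra|].
    rewrite offset_PI; f_equal; ring.
Qed.

Lemma rings_orthogonal_of_distp (K L : ring) :
  0 < outer K -> 0 < outer L ->
  distp (center K) (center L) * distp (center K) (center L) =
    outer K * outer K + inner L * inner L ->
  distp (center K) (center L) * distp (center K) (center L) =
    outer L * outer L + inner K * inner K ->
  rings_orthogonal K L.
Proof.
intros HK HL H1 H2; split; apply distp_orthogonal; trivial; try nra.
unfold distp in *; rewrite distance_symm; trivial.
Qed.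

(** * Integration of the angles and of the centers *)

Lemma developed_angles (G : vertex -> bool) (rho : vertex -> R) :
  simply_connected (dual G) ->
  (forall v, inner_vertex G v ->
    turn (rho (east v) - rho v) + turn (rho (north v) - rho v) +
    turn (rho (west v) - rho v) + turn (rho (south v) - rho v) = 0) ->
  exists theta : vertex -> R, forall s, G s = true ->
    (G (east s) = true ->
     theta (east s) = theta s + turn (rho (east s) - rho (north (east s)))) /\
    (G (north s) = true ->
     theta (north s) = theta s + turn (rho (north (east s)) - rho (north s))).
Proof.
intros HD Heq.
destruct (lattice_potential (dual G)
  (fun s => turn (rho (east s) - rho (north (east s))))
  (fun s => turn (rho (north (east s)) - rho (north s))) HD (dual_edge G)) as [th Hth].
(* The dual face [s] surrounds the inner vertex [north (east s)]; closedness there is the equation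
   at that vertex, with two turns reversed by oddness. *)
{ cbn -[In]; intros s Hs.
  assert (H1 := Hs s ltac:(cbn; auto)); assert (H2 := Hs (east s) ltac:(cbn; auto)).
  assert (H3 := Hs (north (east s)) ltac:(cbn; auto)).
  assert (H4 := Hs (north s) ltac:(cbn; auto)).
  set (v := north (east s)) in *.
  assert (Ws : west v = north s)
    by (unfold v; change (west (north (east s))) with (north (west (east s)));
        now rewrite west_east).
  assert (Ss : south v = east s) by apply south_north.
  assert (Hv : inner_vertex G v).
  { split; [exists s; cbn; auto|].
    unfold Val, neighbors, edge_h, edge_v.
    rewrite Ws, Ss, H2, H3, H4; reflexivity. }
  specialize (Heq v Hv).
  rewrite Ws, Ss in Heq.
  change (north (east (east s))) with (east v).
  change (north (east (north s))) with (north v).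
  change (east (north s)) with v.
  assert (E1 : turn (rho v - rho (north v)) = - turn (rho (north v) - rho v))
    by (rewrite <- turn_opp; f_equal; ring).
  assert (E2 : turn (rho v - rho (north s)) = - turn (rho (north s) - rho v))
    by (rewrite <- turn_opp; f_equal; ring).
  lra. }
exists th; intros s Hs; split; intros Hs'; rewrite (Hth s); trivial.
- now rewrite increment_east.
- cbn; auto.
- now rewrite increment_north.
- cbn; auto.
Qed.

Lemma developed_centers (l0 : R) (G : vertex -> bool) (rho theta : vertex -> R) :
  0 < l0 -> simply_connected (primal G) ->
  (forall s, G s = true ->
    (G (east s) = true ->
     theta (east s) = theta s + turn (rho (east s) - rho (north (east s)))) /\
    (G (north s) = true ->
     theta (north s) = theta s + turn (rho (north (east s)) - rho (north s)))) ->
  exists P : vertex -> ring, (forall v, has_radii l0 rho P v) /\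
    forall s, G s = true -> square_frame P s (theta s).
Proof.
intros Hl HG Hth.
pose (Ro v := l0 * cosh (rho v)); pose (ri v := l0 * sinh (rho v)).
(* Edge vectors are read in the square above or to the right when it is present, otherwise in the
   other one. [H3] and [H4] show that the choice does not matter. *)
pose (hvec v := if G v
  then offset (0, 0) (- Ro (east v)) (- ri v) (theta v)
  else offset (0, 0) (- Ro v) (- ri (east v)) (theta (south v))).
pose (vvec v := if G v
  then offset (0, 0) (Ro (north v)) (- ri v) (theta v)
  else offset (0, 0) (Ro v) (- ri (north v)) (theta (west v))).
assert (H1 : forall s, G s = true ->
  hvec s = offset (0, 0) (- Ro (east s)) (- ri s) (theta s))
  by (intros s Hs; unfold hvec; now rewrite Hs).
assert (H2 : forall s, G s = true ->
  vvec s = offset (0, 0) (Ro (north s)) (- ri s) (theta s))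
  by (intros s Hs; unfold vvec; now rewrite Hs).
assert (H3 : forall s, G s = true ->
  hvec (north s) = offset (0, 0) (- Ro (north s)) (- ri (north (east s))) (theta s)).
{ intros s Hs; unfold hvec; destruct (G (north s)) eqn:E.
  - symmetry; apply east_turn; trivial.
    now rewrite (proj2 (Hth s Hs) E).
  - now rewrite south_north. }
assert (H4 : forall s, G s = true ->
  vvec (east s) = offset (0, 0) (Ro (east s)) (- ri (north (east s))) (theta s)).
{ intros s Hs; unfold vvec; destruct (G (east s)) eqn:E.
  - symmetry; apply north_turn; trivial.
    now rewrite (proj1 (Hth s Hs) E).
  - now rewrite west_east. }
destruct (lattice_potential (primal G) (fun v => fst (hvec v)) (fun v => fst (vvec v)) HG
  (primal_edge G)) as [hx Hx].
(* In the single frame of [s], both ways to the opposite corner have first coordinate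
   [Ro (north s) - Ro (north s) = 0] and second coordinate [- ri s - ri (north (east s))]. *)
{ intros s Hs; rewrite (H1 s Hs), (H2 s Hs), (H3 s Hs), (H4 s Hs); unfold offset; cbn [fst snd]; ring. }
destruct (lattice_potential (primal G) (fun v => snd (hvec v)) (fun v => snd (vvec v)) HG
  (primal_edge G)) as [hy Hy].
{ intros s Hs; rewrite (H1 s Hs), (H2 s Hs), (H3 s Hs), (H4 s Hs); unfold offset; cbn [fst snd]; ring. }
cbn [cvert cedge primal] in Hx, Hy.
exists (fun v => Ring (hx v, hy v) (ri v) (Ro v)).
split; [intros v; split; reflexivity|].
intros s Hs; exists (offset (hx s, hy s) 0 (- ri s) (theta s)); cbn [center inner outer].
assert (Vs : forall u, In u (corners s) -> in_V G u) by (intros u Hu; exists s; auto).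
assert (Ae : adj G s (east s))
  by (apply adj_square; exists s; unfold square_edge; cbn; auto).
assert (An : adj G s (north s))
  by (apply adj_square; exists s; unfold square_edge; cbn; auto).
assert (Ane : adj G (east s) (north (east s)))
  by (apply adj_square; exists s; unfold square_edge; cbn; auto 10).
rewrite (Hx (east s) (north (east s))), (Hy (east s) (north (east s)))
  by (assumption || (apply Vs; cbn; auto)).
rewrite (Hx s (east s)), (Hy s (east s)), (Hx s (north s)), (Hy s (north s))
  by (assumption || (apply Vs; cbn; auto)).
rewrite !increment_east, !increment_north, (H1 s Hs), (H2 s Hs), (H4 s Hs).
rewrite !offset_offset.
split; [|split; [|split]]; unfold offset; cbn; f_equal; ring.
Qed.

(** At most one of the four squares is missing, and its frame follows from the
    others. *)
Lemma quadrant_frames (G : vertex -> bool) (rho theta : vertex -> R) (v : vertex) :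
  simply_connected (primal G) -> simply_connected (dual G) ->
  (forall s, G s = true ->
    (G (east s) = true ->
     theta (east s) = theta s + turn (rho (east s) - rho (north (east s)))) /\
    (G (north s) = true ->
     theta (north s) = theta s + turn (rho (north (east s)) - rho (north s)))) ->
  Val G v = 4%nat ->
  turn (rho (east v) - rho v) + turn (rho (north v) - rho v) +
  turn (rho (west v) - rho v) + turn (rho (south v) - rho v) = 0 ->
  exists t1 t2 t3 t4,
    t2 = t1 + turn (rho (north v) - rho v) /\
    t3 = t2 + turn (rho (west v) - rho v) /\
    t4 = t3 + turn (rho (south v) - rho v) /\
    t1 = t4 + turn (rho (east v) - rho v) /\
    (G v = true -> t1 = theta v) /\
    (G (west v) = true -> t2 = theta (west v)) /\
    (G (west (south v)) = true -> t3 = theta (west (south v))) /\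
    (G (south v) = true -> t4 = theta (south v)).
Proof.
intros HG HD Hth HV Heq.
assert (P1 := no_pinch_NE_SW G v HG HD); assert (P2 := no_pinch_NW_SE G v HG HD).
assert (T : forall w, turn (rho v - rho w) = - turn (rho w - rho v))
  by (intros w; rewrite <- turn_opp; f_equal; ring).
assert (E4 : G (west (south v)) = true -> G (south v) = true ->
  theta (south v) = theta (west (south v)) + turn (rho (south v) - rho v)).
{ intros Hs Hs'; assert (H := proj1 (Hth _ Hs)).
  rewrite east_west, north_south in H; auto. }
assert (E3 : G (west (south v)) = true -> G (west v) = true ->
  theta (west (south v)) = theta (west v) + turn (rho (west v) - rho v)).
{ intros Hs Hs'; assert (H := proj2 (Hth _ Hs)).
  rewrite east_west, north_south in H.
  change (north (west (south v))) with (west (north (south v))) in H.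
  rewrite north_south in H; specialize (H Hs'); rewrite T in H; lra. }
assert (E1 : G (south v) = true -> G v = true ->
  theta v = theta (south v) + turn (rho (east v) - rho v)).
{ intros Hs Hs'; assert (H := proj2 (Hth _ Hs)).
  change (north (east (south v))) with (east (north (south v))) in H.
  rewrite north_south in H; auto. }
assert (E2 : G (west v) = true -> G v = true ->
  theta (west v) = theta v + turn (rho (north v) - rho v)).
{ intros Hs Hs'; assert (H := proj1 (Hth _ Hs)).
  rewrite east_west in H; specialize (H Hs'); rewrite T in H; lra. }
unfold Val, neighbors, edge_h, edge_v in HV.
change (south (west v)) with (west (south v)) in HV.
set (e := turn (rho (east v) - rho v)) in *.
set (n := turn (rho (north v) - rho v)) in *.
set (w := turn (rho (west v) - rho v)) in *.
set (s := turn (rho (south v) - rho v)) in *.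
(* Valence four leaves the two pairs of opposite squares, ruled out by [P1] and [P2], and the five
   cases with at most one square missing. *)
destruct (G v), (G (west v)), (G (west (south v))), (G (south v)); cbn in HV;
  try discriminate; try (exfalso; tauto).
- exists (theta v), (theta (west v)), (theta (west (south v))), (theta (south v)); auto 10.
- exists (theta v), (theta (west v)), (theta (west (south v))),
    (theta (west (south v)) + s).
  repeat split; auto; try discriminate.
  specialize (E2 eq_refl eq_refl); specialize (E3 eq_refl eq_refl); lra.
- exists (theta v), (theta (west v)), (theta (west v) + w), (theta (south v)).
  repeat split; auto; try discriminate.
  specialize (E1 eq_refl eq_refl); specialize (E2 eq_refl eq_refl); lra.
- exists (theta v), (theta v + n), (theta (west (south v))), (theta (south v)).
  repeat split; auto; try discriminate.
  specialize (E1 eq_refl eq_refl); specialize (E4 eq_refl eq_refl); lra.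
- exists (theta (south v) + e), (theta (west v)), (theta (west (south v))),
    (theta (south v)).
  repeat split; auto; try discriminate.
  specialize (E3 eq_refl eq_refl); specialize (E4 eq_refl eq_refl); lra.
Qed.

Lemma pattern_of_radii (l0 : R) (G : vertex -> bool) (rho : vertex -> R) :
  0 < l0 -> simply_connected (primal G) -> simply_connected (dual G) ->
  (forall v, inner_vertex G v ->
    turn (rho (east v) - rho v) + turn (rho (north v) - rho v) +
    turn (rho (west v) - rho v) + turn (rho (south v) - rho v) = 0) ->
  exists P, ring_pattern G P /\ rho_radii l0 G P rho.
Proof.
intros Hl HG HD Heq.
destruct (developed_angles G rho HD Heq) as [theta Hth].
destruct (developed_centers l0 G rho theta Hl HG Hth) as (P & Hr & Hf).
exists P; split; [|intros v _; apply Hr].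
assert (Hpos : forall v, 0 < outer (P v)).
{ intros v; rewrite (proj1 (Hr v)); apply Rmult_lt_0_compat; auto using cosh_pos. }
(* Equality of areas makes the two orthogonality relations of an edge equivalent. *)
assert (Harea : forall v, outer (P v) * outer (P v) = l0 * l0 + inner (P v) * inner (P v)).
{ intros v; destruct (Hr v) as [-> ->].
  transitivity (l0 * l0 * (cosh (rho v) * cosh (rho v))); [ring|].
  rewrite cosh_sqr; ring. }
split.
- intros v _; split; trivial.
  pose proof (Harea v); pose proof (Hpos v); pose proof (Rabs_pos (inner (P v))).
  pose proof (sqr_Rabs (inner (P v))); nra.
- assert (Hsq : forall s v w, G s = true -> square_edge s v w ->
    rings_orthogonal (P v) (P w)).
  { intros s v w Hs Hvw.
    apply (square_edge_offset l0 rho) in Hvw as (a & b & Hab & H).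
    specialize (H P (theta s) (fun u _ => Hr u) (Hf s Hs)).
    rewrite <- !(proj2 (Hr _)) in Hab.
    assert (Hd : distp (center (P v)) (center (P w)) *
      distp (center (P v)) (center (P w)) = a * a + b * b).
    { unfold distp; rewrite distance_symm; fold (distp (center (P w)) (center (P v))).
      rewrite H; apply distp_offset_origin. }
    apply rings_orthogonal_of_distp; trivial; rewrite Hd, Hab, Harea; ring. }
  intros v w _ Hvw; apply adj_square in Hvw as (s & Hs & [H | H]);
    [eapply Hsq; eauto|].
  destruct (Hsq s w v Hs H); now split.
- intros s Hs; destruct (Hf s Hs) as (x & A1 & A2 & A3 & A4).
  exists x.
  assert (T1 := frame_touch_on_inner (P s) (P (east s)) (P (north s)) x (theta s)
    (Hpos _) (Hpos _) A1 A2 A4).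
  assert (T2 : touch_on_inner (P (north (east s))) (P (north s)) (P (east s)) x).
  { apply frame_touch_on_inner with (theta s + PI); trivial; rewrite offset_PI.
    - rewrite A3; f_equal; ring.
    - rewrite A4; f_equal; ring.
    - rewrite A2; f_equal; ring. }
  unfold touch_on_inner, square_point, square_oriented in *; tauto.
- intros v Hv; specialize (Heq v Hv).
  destruct (quadrant_frames G rho theta v HG HD Hth (proj2 Hv) Heq)
    as (t1 & t2 & t3 & t4 & T2 & T3 & T4 & T1 & F1 & F2 & F3 & F4).
  assert (F := fun s Hs => square_frame_edges P s (theta s) (Hf s Hs)).
  assert (G1 := F v); assert (G2 := F (west v)); assert (G3 := F (west (south v)));
  assert (G4 := F (south v)); clear F.
  change (north (west (south v))) with (west (north (south v))) in G3.
  change (north (east (south v))) with (east (north (south v))) in G4.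
  rewrite east_west in G2; rewrite east_west, north_south in G3.
  rewrite north_south in G4.
  assert (Hedges : (G v = true \/ G (south v) = true) /\ (G v = true \/ G (west v) = true) /\
    (G (west v) = true \/ G (west (south v)) = true) /\
    (G (west (south v)) = true \/ G (south v) = true)).
  { assert (HV := proj2 Hv); unfold Val, neighbors, edge_h, edge_v in HV.
    change (south (west v)) with (west (south v)) in HV.
    destruct (G v), (G (west v)), (G (west (south v))), (G (south v)); cbn in HV;
    try discriminate; tauto. }
  destruct Hedges as (He & Hn & Hw & Hs).
  apply star_touching_points with l0 rho t1 t2 t3 t4; trivial.
  + destruct He as [H | H]; [left; rewrite (F1 H) | right; rewrite (F4 H)].
    * apply (G1 H).
    * apply (G4 H).
  + destruct Hn as [H | H]; [left; rewrite (F1 H) | right; rewrite (F2 H)].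
    * apply (G1 H).
    * apply (G2 H).
  + destruct Hw as [H | H]; [left; rewrite (F2 H) | right; rewrite (F3 H)].
    * apply (G2 H).
    * apply (G3 H).
  + destruct Hs as [H | H]; [left; rewrite (F3 H) | right; rewrite (F4 H)].
    * apply (G3 H).
    * apply (G4 H).
Qed.

Theorem theorem2p4 (l0 : R) (G : vertex -> bool) (hl0 : 0 < l0)
    (hG : simply_connected (primal G)) (hGdual : simply_connected (dual G)) :
  (forall (P Q : vertex -> ring) (rho : vertex -> R),
     ring_pattern G P -> ring_pattern G Q ->
     rho_radii l0 G P rho -> rho_radii l0 G Q rho ->
     congruent G P Q)
  /\
  (forall rho Theta : vertex -> R,
     (exists P : vertex -> ring,
        ring_pattern G P /\ rho_radii l0 G P rho /\
        forall i, boundary_vertex G i -> rho i <> 0 -> cone_angle G P i = Theta i)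
     <->
     (forall i,
        (inner_vertex G i ->
           Rsum (map (fun j => 2 * atan (exp (rho i - rho j))) (neighbors G i))
           = 2 * PI) /\
        (boundary_vertex G i -> rho i > 0 ->
           Rsum (map (fun j => 2 * atan (exp (rho i - rho j))) (neighbors G i))
           = PI * INR (Val G i) - Theta i) /\
        (boundary_vertex G i -> rho i < 0 ->
           Rsum (map (fun j => 2 * atan (exp (rho i - rho j))) (neighbors G i))
           = - Theta i))).
Proof.
assert (sgn_pos : forall x, x > 0 -> sgn x = 1)
  by (intros x Hx; unfold sgn; destruct (Rlt_dec 0 x); lra).
assert (sgn_neg : forall x, x < 0 -> sgn x = -1)
  by (intros x Hx; unfold sgn; destruct (Rlt_dec 0 x), (Rlt_dec x 0); lra).
split.
- intros P Q rho; now apply (pattern_congruent l0).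
- intros rho Theta; split.
  + intros (P & HP & Hr & HT) i; split; [|split].
    * intros Hi; apply (inner_sum G); [apply Hi|].
      now apply (inner_equation l0 G P).
    * intros Hi Hrho; rewrite (cone_angle_sum l0 G P rho i), HT, sgn_pos;
        trivial; try apply Hi; try lra.
    * intros Hi Hrho; rewrite (cone_angle_sum l0 G P rho i), HT, sgn_neg;
        trivial; try apply Hi; try lra.
  + intros H.
    (* The equations at inner vertices produce the pattern; those at the boundary then identify its
       cone angles, which are functions of the radii. *)
    destruct (pattern_of_radii l0 G rho hl0 hG hGdual) as (P & HP & Hr).
    { intros v Hv; apply (inner_sum G); [apply Hv|now apply H]. }
    exists P; split; [|split]; trivial.
    intros i Hi Hrho; destruct (H i) as (_ & Hpos & Hneg).
    assert (E := cone_angle_sum l0 G P rho i hl0 (proj1 Hi) Hr Hrho).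
    destruct (Rtotal_order (rho i) 0) as [D | [D | D]]; [|contradiction|].
    * rewrite (Hneg Hi D), sgn_neg in E by trivial; lra.
    * rewrite (Hpos Hi D), sgn_pos in E by trivial; lra.
Qed.
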